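(* (i) Let $T=(V,E)$ be a rooted tree as described in the context, and let $\mu^A$ be the equilibrium measure (for $p=2$) of a (capacitable) set $A\subseteq\partial T$. Then there exists a square tiling $\{Q_\alpha\}_{\alpha\in E}$ of the rectangle $R=[0,c_2(A)]\times[0,1]$, whose combinatorics are prescribed by $T$, and such that for each $\alpha\in E$ the square $Q_\alpha$ has side of length $\ell(\alpha)=\mu^A(\partial T_\alpha)$. (ii) Conversely, suppose that a rectangle $R=[0,c]\times[0,1]$, $c\le1$, is square-tiled by a family $\{Q_\alpha\}_{\alpha\in E}$, where $Q_\alpha$ has side length $\ell(\alpha)$, with combinatorics prescribed by a rooted tree $T=(V,E)$ as described in the context. Then there exists an $F_\sigma$ subset $A$ of $\partial T$ such that the measure $\mu$ on $\partial T$ given by $\mu(\partial T_\alpha)=\ell(\alpha)$, $\alpha\in E$, is the equilibrium measure (for $p=2$) of $A$, and then $c_2(A)=c$.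
   Context: Tree. $T$ is an infinite, locally finite tree (connected graph without cycles, each vertex having finitely many neighbours) with vertex set $V$. It is rooted at a vertex $o$ which is an endpoint of exactly one edge $\omega$ (the root edge), and no vertex other than $o$ is a leaf (every vertex $\neq o$ has at least two neighbours). $\partial T$ is the set of infinite geodesic rays starting at $o$, and $\overline V=V\cup\partial T$. For $y\in V$, $\xi\in\overline V$ write $y\le\xi$ if $y$ lies on the geodesic from $o$ to $\xi$. $E$ is the set of edges, oriented away from $o$: each edge $\alpha$ has a beginning vertex $b(\alpha)$ and an ending vertex $e(\alpha)$, adjacent, with $b(\alpha)<e(\alpha)$. For $\xi\in\overline V$, $\alpha<\xi$ means $e(\alpha)\le\xi$. $\partial T_\alpha$ is the set of rays in $\partial T$ passing through $\alpha$; the sets $\partial T_\alpha$, $\alpha\in E$, form a basis of the topology of $\partial T$, which is compact and metrizable. Capacity ($p=2$). For $f:E\to[0,\infty)$ let $If(\xi)=\sum_{\alpha\in E,\ \alpha<\xi}f(\alpha)$. For $A\subseteq\partial T$ let $\Omega_A=\{f\in\ell^2(E): f\ge0,\ If\ge1\text{ on }A\}$ and $c_2(A)=\inf_{f\in\Omega_A}\|f\|_2^2$. There is a unique $f^A$ in the $\ell^2$-closure of $\Omega_A$ with $\|f^A\|_2^2=c_2(A)$. $A$ is capacitable if $c_2(A)=\sup\{c_2(K):K\subseteq A\text{ compact}\}=\inf\{c_2(G):G\supseteq A\text{ open}\}$; all Suslin (in particular Borel) sets are capacitable. For capacitable $A$, the equilibrium measure of $A$ (for $p=2$) is the unique nonnegative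 Borel measure $\mu^A$ on $\partial T$, supported in $\overline A$, such that $\mu^A(\partial T_\alpha)=f^A(\alpha)$ for all $\alpha\in E$; it satisfies $\mu^A(\overline A)=c_2(A)=\sum_{\alpha\in E}\mu^A(\partial T_\alpha)^2$. Tilings. Rectangles and squares are closed, with sides parallel to the coordinate axes of $\mathbb{R}^2$; squares may be degenerate (side $0$, a single point). A family of squares $\{Q_j\}_j$ is a square tiling of a rectangle $R$ if the interiors of $Q_i$ and $Q_j$ are disjoint for $i\ne j$ and $R=\overline{\bigcup_jQ_j}$ (closure of the union). For a square $Q_\alpha$ let $B(\alpha)$ and $E(\alpha)$ denote its upper and lower side, respectively. The combinatorics of a family of squares are prescribed by the tree $T$ if the squares are indexed by the edges of $T$, $\{Q_\alpha:\alpha\in E\}$, and $B(\alpha)\subseteq E(\beta)$ whenever $b(\alpha)=e(\beta)$.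
   Formalization: Stated with c_2(A)>0 in (i) and c>0 in (ii); (ii) also has two extra hypotheses, both necessary for its conclusion: no square of positive side touches the bottom side of R, and the squares cover R up to a Lebesgue-null set. *)

(* Defs.v *)
From HB Require Import structures.
From mathcomp Require Import all_boot all_order all_algebra.
From mathcomp Require Import all_classical all_reals all_analysis.
Import Order.TTheory GRing.Theory Num.Theory.
Import numFieldNormedType.Exports.

Set Implicit Arguments.
Unset Strict Implicit.
Unset Printing Implicit Defensive.

Local Open Scope classical_set_scope.
Local Open Scope ring_scope.

(** No cycles: there is no simple closed walk through at least three vertices. *)
Record rooted_tree := RootedTree {
  vertex :> choiceType ;
  adj : rel vertex ;
  root : vertex ;
  adj_sym : symmetric adj ;
  adj_irr : irreflexive adj ;
  tree_connected : forall x y, exists2 p, path adj x p & last x p = y ;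
  tree_acyclic : forall p : seq vertex,
    (2 < size p)%N -> uniq p -> ~~ cycle adj p ;
  tree_locally_finite : forall x, finite_set [set y | adj x y] ;
  tree_infinite : infinite_set [set: vertex] ;
  root_leaf : exists! y, adj root y ;
  nonroot_nonleaf : forall x, x != root ->
    exists y z, [/\ y != z, adj x y & adj x z]
}.

(** [x :: p] is a shortest walk between its endpoints. *)
Definition geodesic (T : rooted_tree) (x : T) (p : seq T) : Prop :=
  path (@adj T) x p /\
  forall q, path (@adj T) x q -> last x q = last x p -> (size p <= size q)%N.

Definition vertex_le (T : rooted_tree) (y x : T) : Prop :=
  exists p, [/\ geodesic (root T) p, last (root T) p = x & y \in root T :: p].

(** Oriented edges [(b, e)] with [b < e]; since adjacent vertices are distinct,
    [b <= e] is enough. *)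
Definition edges (T : rooted_tree) : set (T * T)%type :=
  [set p | adj p.1 p.2 /\ vertex_le p.1 p.2].

Definition edge (T : rooted_tree) : Type := set_type (@edges T).
HB.instance Definition _ (T : rooted_tree) := Choice.on (edge T).

Definition edge_begin (T : rooted_tree) (a : edge T) : T := (val a).1.
Definition edge_end (T : rooted_tree) (a : edge T) : T := (val a).2.

Definition is_ray (T : rooted_tree) (xi : nat -> T) : Prop :=
  xi 0%N = root T /\ forall n, geodesic (root T) (mkseq (fun i => xi i.+1) n).

Definition boundary (T : rooted_tree) : Type :=
  set_type [set xi : nat -> T | is_ray xi].

Definition ray_through (T : rooted_tree) (y : T) (xi : boundary T) : Prop :=
  exists n, val xi n = y.

Definition cylinder (T : rooted_tree) (a : edge T) : set (boundary T) :=
  [set xi | ray_through (edge_end a) xi].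

Section RootedTreeFacts.
Variable T : rooted_tree.
Implicit Types (x y : T) (p q : seq T).

Lemma simple_path_unique x p q :
  path (@adj T) x p -> path (@adj T) x q -> uniq (x :: p) -> uniq (x :: q) ->
  last x p = last x q -> p = q.
Proof.
elim: p x q => [|a p IH] x [|b q] //=.
- by move=> _ _ _ /andP[xq _] e; rewrite e mem_last in xq.
- by move=> _ _ /andP[xp _] _ e; rewrite -e mem_last in xp.
move=> /andP[xa pa] /andP[xb qb] /andP[xap uap] /andP[xbq ubq] e.
have [ab|ab] := eqVneq a b.
  by subst b; congr cons; apply: (IH a).
exfalso.
have hasp : has (mem (b :: q)) (a :: p).
  by apply/hasP; exists (last a p); rewrite ?mem_last //= e mem_last.
have [z [p1 [p2 [E1 zq p1q]]]] : exists z p1 p2,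
    [/\ a :: p = p1 ++ z :: p2, z \in b :: q & ~~ has (mem (b :: q)) p1].
  move: hasp; move: (a :: p) => s hs; case: (split_find hs) => z s1 s2 zq ns1.
  by exists z, s1, s2; rewrite cat_rcons.
have [q1 [q2 E2]] : exists q1 q2, b :: q = q1 ++ z :: q2.
  by case/splitPr: zq => q1 q2; exists q1, q2.
have px : path (@adj T) x (p1 ++ z :: p2) by rewrite -E1 /= xa.
have qx : path (@adj T) x (q1 ++ z :: q2) by rewrite -E2 /= xb.
have ux : uniq (x :: p1 ++ z :: p2) by rewrite -E1 /= xap.
have uq : uniq (x :: q1 ++ z :: q2) by rewrite -E2 /= xbq.
suff: cycle (@adj T) (x :: p1 ++ z :: rev q1).
  apply/negP/tree_acyclic.
    rewrite /= size_cat /= size_rev.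
    case: p1 q1 E1 E2 {p1q px qx ux uq} => [|c p1] [|d q1] /=; rewrite ?addnS //.
    by move=> [az _] [bz _]; rewrite az bz eqxx in ab.
  move: ux uq; rewrite /= !mem_cat !inE mem_rev !cat_uniq /= rev_uniq mem_rev.
  move=> /andP[xp /andP[up1 /andP[/norP[zp1 _] _]]].
  move=> /andP[xq /andP[uq1 /andP[/norP[zq1 _] _]]].
  rewrite up1 uq1 (negbTE zp1) zq1 /= !andbT.
  move: xp xq; rewrite !negb_or => /andP[-> /andP[-> _]] /andP[-> _] /=.
  apply/hasPn => y; rewrite mem_rev => yq1.
  apply: contra p1q => yp1; apply/hasP; exists y => //=.
  by rewrite E2 mem_cat yq1.
rewrite /= rcons_cat cat_path /=.
move: px; rewrite cat_path /= => /and3P[-> -> _] /=.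
move: qx; rewrite -cat_rcons cat_path => /andP[+ _].
rewrite (@eq_path _ _ (fun u v => adj v u)); last by move=> u v; rewrite (@adj_sym T).
by rewrite -rev_path last_rcons belast_rcons rev_cons.
Qed.

Lemma geodesic_simple x p : geodesic x p -> uniq (x :: p).
Proof.
move=> [pp mp]; have {mp} := mp (shorten x p).
case: (shortenP pp) => p' pp' up' sub /(_ pp' erefl) le.
have sub' : {subset x :: p' <= x :: p}.
  by move=> y; rewrite !inE => /orP[->//|/sub ->]; rewrite orbT.
have [e1 e2] := uniq_min_size up' sub' le.
by rewrite -(eq_uniq e1 e2).
Qed.

Lemma simple_geodesic x p : path (@adj T) x p -> uniq (x :: p) -> geodesic x p.
Proof.
move=> pp up; split=> // q pq; case: (shortenP pq) => q' pq' uq' sub e.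
rewrite (@simple_path_unique x p q') //.
by apply: uniq_leq_size => //; case/andP: uq'.
Qed.

Lemma geodesic_unique x p q :
  geodesic x p -> geodesic x q -> last x p = last x q -> p = q.
Proof.
move=> gp gq; apply: simple_path_unique; try exact: geodesic_simple.
  by case: gp.
by case: gq.
Qed.

Lemma geodesic_extend p : geodesic (root T) p -> exists z, geodesic (root T) (rcons p z).
Proof.
move=> gp; have up := geodesic_simple gp; have pp := gp.1.
suff [z az zp] : exists2 z, adj (last (root T) p) z & z \notin (root T) :: p.
  exists z; apply: simple_geodesic; first by rewrite rcons_path pp.
  by rewrite -rcons_cons rcons_uniq zp.
have [-> /=|p0] := eqVneq p [::].
  have [y [ay _]] := root_leaf T; exists y => //; rewrite inE.
  by apply: contraTneq ay => ->; rewrite (@adj_irr T).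
have cr : last (root T) p != (root T).
  case: p p0 up {gp pp} => //= a p _ /andP[rp _].
  by apply: contraNneq rp => <-; rewrite mem_last.
have [y [z [yz ay az]]] := nonroot_nonleaf cr.
have [yp|] := boolP (y \in (root T) :: p); last by exists y.
have [zp|] := boolP (z \in (root T) :: p); last by exists z.
exfalso.
have back w : adj (last (root T) p) w -> w \in (root T) :: p ->
    exists2 p', p = rcons p' (last (root T) p) & last (root T) p' = w.
  move=> aw wp; move: up pp aw; case: (splitPl wp) => p1 p2 lw.
  rewrite cat_path => up /andP[pp1 pp2] aw; exists p1 => //.
  apply: (@simple_path_unique (root T)) => //.
  - by rewrite cat_path pp1.
  - by rewrite rcons_path pp1 lw (@adj_sym T).
  - rewrite -rcons_cons rcons_uniq.
    have : uniq ((root T) :: p1) by move: up; rewrite -cat_cons cat_uniq => /andP[].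
    move=> ->; rewrite andbT last_cat.
    case: p2 up aw {pp2 wp} => [|a p2] up.
      by rewrite cats0 lw (@adj_irr T).
    rewrite -cat_cons cat_uniq in up; case/and3P: up => _ /hasPn up _ _.
    by apply: up; rewrite /= mem_last.
  - by rewrite last_rcons.
have [p1 e1 l1] := back _ ay yp; have [p2 e2 l2] := back _ az zp.
have [e12] := rcons_inj (etrans (esym e1) e2).
by rewrite -l1 -l2 e12 eqxx in yz.
Qed.

Lemma geodesic_ray (p : nat -> seq T) :
  p 0%N = [::] -> (forall n, geodesic (root T) (p n)) ->
  (forall n, exists z, p n.+1 = rcons (p n) z) ->
  is_ray (fun n => last (root T) (p n)).
Proof.
move=> p0 gp pS; split; first by rewrite p0.
move=> n; suff -> : mkseq (fun i => last (root T) (p i.+1)) n = p n by [].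
elim: n => [|n IH]; first by rewrite p0.
by rewrite mkseqS IH; have [z ->] := pS n; rewrite last_rcons.
Qed.

Lemma ray_exists : exists xi : nat -> T, is_ray xi.
Proof.
pose G := {p : seq T | geodesic (root T) p}.
have g0 : geodesic (root T) [::] by split.
have step (g : G) : {g' : G | exists z, sval g' = rcons (sval g) z}.
  case: g => p gp; have [z gz] := cid (geodesic_extend gp).
  by exists (exist _ _ gz); exists z.
pose s n := iter n (fun g => sval (step g)) (exist _ [::] g0 : G).
exists (fun n => last (root T) (sval (s n))).
apply: (@geodesic_ray (fun n => sval (s n))) => // n; first exact: svalP.
by rewrite /s iterS; case: (step _).
Qed.

Lemma last_ray (xi : nat -> T) n :
  is_ray xi -> last (root T) (mkseq (fun i => xi i.+1) n) = xi n.
Proof.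
by move=> [x0 _]; case: n => [|n]; rewrite ?x0 // mkseqS last_rcons.
Qed.

Lemma ray_eq_prefix (xi eta : nat -> T) n m :
  is_ray xi -> is_ray eta -> xi n = eta m ->
  n = m /\ forall i, (i <= n)%N -> xi i = eta i.
Proof.
move=> rx re e.
have E : mkseq (fun i => xi i.+1) n = mkseq (fun i => eta i.+1) m.
  by apply: (geodesic_unique (rx.2 n) (re.2 m)); rewrite !last_ray.
have nm : n = m by rewrite -(size_mkseq (fun i => xi i.+1) n) E size_mkseq.
split=> // -[|i] lein; first by rewrite rx.1 re.1.
by rewrite -(nth_mkseq (root T) (fun i => xi i.+1) lein) E nth_mkseq // -nm.
Qed.

Lemma ray_edge (xi : nat -> T) n : is_ray xi -> edges (xi n, xi n.+1).
Proof.
move=> rx; have g := rx.2 n.+1; have p := g.1; split => /=.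
  by move: p; rewrite mkseqS rcons_path last_ray // => /andP[].
exists (mkseq (fun i => xi i.+1) n.+1); split; rewrite ?last_ray //.
rewrite mkseqS -rcons_cons mem_rcons inE; apply/orP; right.
by rewrite -(last_ray n rx) mem_last.
Qed.

End RootedTreeFacts.

HB.instance Definition _ (T : rooted_tree) := Choice.on (boundary T).
HB.instance Definition _ (T : rooted_tree) := isPointed.Build (boundary T)
  (exist (fun xi => xi \in [set xi | is_ray xi])
     (sval (cid (ray_exists T))) (mem_set (svalP (cid (ray_exists T))))).

Definition edge_of_ray (T : rooted_tree) (xi : boundary T) (n : nat) : edge T :=
  exist (fun p => p \in @edges T) (val xi n, val xi n.+1)
    (mem_set (ray_edge n (set_mem (valP xi)))).

HB.instance Definition _ (T : rooted_tree) :=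
  isPointed.Build (edge T) (edge_of_ray point 0).

Section BoundaryTopology.
Variable T : rooted_tree.

Let cylinder_cover : \bigcup_(a in [set: edge T]) cylinder a = setT.
Proof.
by rewrite -subTset => xi _; exists (edge_of_ray xi 0) => //; exists 1%N.
Qed.

Let cylinder_join (a b : edge T) (xi : boundary T) :
  [set: edge T] a -> [set: edge T] b ->
  cylinder a xi -> cylinder b xi ->
  exists k, [/\ [set: edge T] k, cylinder k xi &
    cylinder k `<=` cylinder a `&` cylinder b].
Proof.
have nested (a' b' : edge T) n m : (n <= m)%N -> val xi n = edge_end a' ->
    val xi m = edge_end b' -> cylinder b' `<=` cylinder a'.
  move=> nm en em eta [k ek].
  have [_ H] := ray_eq_prefix (set_mem (valP xi)) (set_mem (valP eta))
    (etrans em (esym ek)).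
  by exists n; rewrite -H.
move=> _ _ ca cb; have [n en] := ca; have [m em] := cb.
have [nm|/ltnW mn] := leqP n m.
  by exists b; split=> // eta be; split=> //; exact: (nested a b n m).
by exists a; split=> // eta be; split=> //; exact: (nested b a m n).
Qed.

HB.instance Definition _ := @isBaseTopological.Build (boundary T)
  (edge T) setT (@cylinder T) cylinder_cover cylinder_join.

End BoundaryTopology.

Definition borel_boundary (T : rooted_tree) :=
  g_sigma_algebraType (@open (boundary T)).

Section Capacity.
Variables (R : realType) (T : rooted_tree).
Implicit Types (f g : edge T -> R) (A K G : set (boundary T)).

Definition potential f (xi : boundary T) : \bar R :=
  \esum_(a in [set a | cylinder a xi]) (f a)%:E.

Definition energy f : \bar R := \esum_(a in [set: edge T]) (f a ^+ 2)%:E.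

Definition admissible A : set (edge T -> R) :=
  [set f | [/\ (energy f < +oo)%E, forall a, 0 <= f a &
              forall xi, A xi -> (1 <= potential f xi)%E]].

Definition capacity A : \bar R := ereal_inf (energy @` admissible A).

Definition l2_closure (F : set (edge T -> R)) : set (edge T -> R) :=
  [set f | (energy f < +oo)%E /\
    forall eps : R, 0 < eps ->
      exists2 g, F g & (energy (fun a => (f a - g a)%R) < eps%:E)%E].

(** At most one [f] satisfies this, by strict convexity of the norm. *)
Definition equilibrium_function A f : Prop :=
  l2_closure (admissible A) f /\ energy f = capacity A.

Definition capacitable A : Prop :=
  capacity A = ereal_sup [set capacity K | K in [set K | compact K /\ K `<=` A]]
  /\
  capacity A = ereal_inf [set capacity G | G in [set G | open G /\ A `<=` G]].

Definition equilibrium_measure A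
    (mu : {measure set (borel_boundary T) -> \bar R}) : Prop :=
  [/\ capacitable A, mu (~` closure A) = 0%E &
    exists2 f, equilibrium_function A f &
      forall a, mu (cylinder a) = (f a)%:E].

End Capacity.

Record square (R : realType) := Square {
  sq_left : R ;
  sq_bottom : R ;
  sq_side : R ;
  sq_side_ge0 : 0 <= sq_side
}.

Section Tilings.
Variable R : realType.
Implicit Types (Q : square R) (D : set (R * R)%type).

Definition sq_xrange Q : set R := `[sq_left Q, sq_left Q + sq_side Q].

Definition sq_set Q : set (R * R)%type :=
  sq_xrange Q `*` `[sq_bottom Q, sq_bottom Q + sq_side Q].

Definition upper_side Q : set (R * R)%type :=
  sq_xrange Q `*` [set sq_bottom Q + sq_side Q].

Definition lower_side Q : set (R * R)%type :=
  sq_xrange Q `*` [set sq_bottom Q].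

Definition rectangle (c : R) : set (R * R)%type := `[0, c] `*` `[0, 1].

Definition square_tiling (I : Type) (Q : I -> square R) D : Prop :=
  (forall i j, i <> j -> (sq_set (Q i))° `&` (sq_set (Q j))° = set0) /\
  D = closure (\bigcup_i sq_set (Q i)).

Definition prescribed_by (T : rooted_tree) (Q : edge T -> square R) : Prop :=
  forall a b : edge T, edge_begin a = edge_end b ->
    upper_side (Q a) `<=` lower_side (Q b).

(** Not implied by [square_tiling]: for an infinite family the union may be dense
    in [D] without having full area. *)
Definition covers_ae (I : Type) (Q : I -> square R) D : Prop :=
  (lebesgue_measure \x lebesgue_measure)%E (D `\` \bigcup_i sq_set (Q i)) = 0%E.

End Tilings.

(* Main.v *)
From mathcomp Require Import all_boot all_order all_algebra.
From mathcomp Require Import all_classical all_reals all_analysis.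
From mathcomp Require Import borel_hierarchy ring lra.
Require Import Defs.
Import Order.TTheory GRing.Theory Num.Theory.
Import numFieldNormedType.Exports.

Set Implicit Arguments.
Unset Strict Implicit.
Unset Printing Implicit Defensive.

Local Open Scope classical_set_scope.
Local Open Scope ring_scope.

(** Both directions rest on the correspondence between flows on the tree and
    stacks of squares. A flow is a nonnegative function on the edges whose value at
    an edge is the sum of its values at the children; equivalently, it is
    [mu (cylinder a)] for a measure [mu] on the boundary. Lay out the values of a
    flow [f] as widths: the children of an edge get adjacent columns that fill the
    column of the edge, and the square of [a], of side [f a], hangs in the column
    of [a] from the square of the parent. The bottom of this square is at height
    [1 - pot f a], where [pot f a] is the sum of [f] along the path to [a].
    Summation by parts along the tree ([flow_pairing]) reads: the area of the
    squares of the first levels is the mean, with respect to the flow, of the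
    potential on the last of these levels.

    From an equilibrium measure to a tiling. The equilibrium function [f] is a flow.
    Its potential is at most 1, because truncating the potential of an admissible
    function at 1 saves energy ([equilibrium_pot_le1]); and its value at the root
    edge is at most its energy [c], because a small multiple of the indicator of
    the root edge can be traded against a rescaling ([equilibrium_root_le]). Hence
    the squares fit in a rectangle of width exactly [c]. They are dense in it: a
    box that meets no square would keep the potential bounded away from 1 on the
    part of the flow that passes over it, and the energy would be less than [c]
    ([column_dense]).

    From a tiling to an equilibrium measure. The prescribed combinatorics forces the
    heights to be [1 - pot s a], with [s] the side lengths, and the children of a
    square to have total side at most that of the square. The area [c] of the
    rectangle is at most the sum of the areas of the squares; comparing with the
    exact balance [area_balance], no square that lies above the bottom of the
    rectangle can be wider than its children together, so [s] is a flow, of energy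
    [c]. The associated measure [mu] is the image of Lebesgue measure on the base
    under the map from a point to the ray of columns above it ([flow_measure]). As
    the energy is [c], the potential of [s] tends to 1 in mean along the levels,
    hence it is at least 1 off open sets of arbitrarily small measure
    ([open_small_bad]). The set [A] is the union of the compact complements of such
    open sets. On [A] the function [s] is admissible, so the capacity is at most
    [c]; conversely, for [g] admissible on one of these compact sets [K],
    [mu K <= \int_K I g dmu <= sum_a g a * s a <= (energy g + c) / 2], so that the
    energy of [g] is at least [2 mu K - c] ([energy_lower_bound]). *)

(** * Edges of the tree by depth *)

Section TreeCombinatorics.
Variable T : rooted_tree.
Implicit Types (x y : T) (a b k : edge T) (p q : seq T) (xi eta : boundary T).

Lemma geodesic_to x : exists p, geodesic (root T) p /\ last (root T) p = x.
Proof.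
have [q pq lq] := tree_connected (root T) x.
case: (shortenP pq) lq => p pp up _ lp.
by exists p; split=> //; apply: simple_geodesic.
Qed.

Definition geo x : seq T := sval (cid (geodesic_to x)).

Lemma geoP x : geodesic (root T) (geo x).
Proof. by rewrite /geo; case: cid => p []. Qed.

Lemma last_geo x : last (root T) (geo x) = x.
Proof. by rewrite /geo; case: cid => p []. Qed.

Lemma geo_eq p x : geodesic (root T) p -> last (root T) p = x -> geo x = p.
Proof. by move=> gp lp; apply: (geodesic_unique (geoP x) gp); rewrite last_geo. Qed.

Lemma geo_root : geo (root T) = [::].
Proof. by apply: geo_eq => //; split. Qed.

Lemma edgeP a : adj (edge_begin a) (edge_end a) /\
  vertex_le (edge_begin a) (edge_end a).
Proof. by case: a => -[b e] H; have := set_mem H. Qed.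

(** The beginning of an edge lies on the geodesic to its end, and simple paths in
    a tree are unique. *)
Lemma geo_edge a : geo (edge_end a) = rcons (geo (edge_begin a)) (edge_end a).
Proof.
have [ad [p [gp lp bp]]] := edgeP a.
have := geodesic_simple gp; have pp := gp.1.
case: (splitPl bp) lp pp => p1 p2 l1; rewrite last_cat l1 cat_path => l2 /andP[pp1 _].
rewrite -cat_cons cat_uniq => /and3P[u1 hp u2].
have ne : edge_end a \notin root T :: p1.
  case: p2 l2 hp {u2 bp gp} => [/= l2|z p2 l2 /hasPn H].
    by move: ad; rewrite -l2 (@adj_irr T).
  by apply: (H (edge_end a)); rewrite -l2 /= mem_last.
have g1 : geodesic (root T) p1 by apply: simple_geodesic.
rewrite (geo_eq g1 l1).
apply: geo_eq; last by rewrite last_rcons.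
apply: simple_geodesic; first by rewrite rcons_path pp1 l1.
by rewrite -rcons_cons rcons_uniq ne.
Qed.

Lemma edge_end_root a : edge_end a != root T.
Proof.
apply/eqP => e; have := geo_edge a; rewrite e geo_root => /(congr1 size).
by rewrite size_rcons.
Qed.

Lemma edge_ext a b : edge_begin a = edge_begin b -> edge_end a = edge_end b -> a = b.
Proof.
case: a b => -[u v] H [[w z] H']; rewrite /edge_begin /edge_end /= => e1 e2.
by subst w z; congr exist; apply: bool_irrelevance.
Qed.

Lemma edge_end_inj a b : edge_end a = edge_end b -> a = b.
Proof.
move=> e; apply: edge_ext => //.
have := geo_edge a; rewrite e geo_edge => /rcons_inj[E].
by rewrite -(last_geo (edge_begin a)) -E last_geo.
Qed.

Lemma edge_to x : x != root T -> exists a, edge_end a = x.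
Proof.
move=> xr; have gx := geoP x; have lx := last_geo x.
case: (lastP (geo x)) gx lx => [_ /= e|p z g]; first by rewrite e eqxx in xr.
rewrite last_rcons => e; subst z.
have pp := g.1; move: pp; rewrite rcons_path => /andP[pp ad].
have H : edges (last (root T) p, x).
  split=> //; exists (rcons p x); split; rewrite ?last_rcons //.
  by rewrite -rcons_cons mem_rcons inE mem_last orbT.
by exists (exist (fun e => e \in @edges T) _ (mem_set H)).
Qed.

(** No vertex other than the root is a leaf, so that every geodesic extends. *)
Lemma edge_from x : exists a, edge_begin a = x.
Proof.
have [z gz] := geodesic_extend (geoP x).
have H : edges (x, z).
  split=> /=.
    by have := gz.1; rewrite rcons_path last_geo => /andP[].
  exists (rcons (geo x) z); split; rewrite ?last_rcons //.
  by rewrite -rcons_cons mem_rcons inE -{2}(last_geo x) mem_last orbT.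
by exists (exist (fun e => e \in @edges T) _ (mem_set H)).
Qed.

Definition depth a : nat := size (geo (edge_begin a)).

Definition child b a := edge_begin a = edge_end b.

Lemma depth_child b a : child b a -> depth a = (depth b).+1.
Proof. by rewrite /child /depth => ->; rewrite geo_edge size_rcons. Qed.

Lemma child_inj b b' a : child b a -> child b' a -> b = b'.
Proof. by rewrite /child => -> /edge_end_inj. Qed.

Definition omega : edge T := sval (cid (edge_from (root T))).

Lemma begin_omega : edge_begin omega = root T.
Proof. by rewrite /omega; case: cid. Qed.

Lemma begin_root a : edge_begin a = root T -> a = omega.
Proof.
move=> e; apply: edge_ext; first by rewrite begin_omega.
have [y [_ uy]] := root_leaf T.
rewrite -(uy (edge_end a)) ?(uy (edge_end omega)) //.
  by have [] := edgeP omega; rewrite begin_omega.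
by have [] := edgeP a; rewrite e.
Qed.

Lemma depth_omega : depth omega = 0%N.
Proof. by rewrite /depth begin_omega geo_root. Qed.

Lemma depth0 a : depth a = 0%N -> a = omega.
Proof.
rewrite /depth => /size0nil e; apply: begin_root.
by rewrite -(last_geo (edge_begin a)) e.
Qed.

Lemma has_parent a : a != omega -> exists b, child b a.
Proof.
move=> ne; have [|b e] := @edge_to (edge_begin a); last by exists b.
by apply: contraNneq ne => /begin_root ->.
Qed.

(** The root edge serves as its own parent. *)
Definition par a : edge T :=
  if pselect (exists b, child b a) is left e then sval (cid e) else omega.

Lemma par_child b a : child b a -> par a = b.
Proof.
rewrite /par => c; case: pselect => [e|[]]; last by exists b.
by case: cid => b' /= c'; apply: child_inj c' c.
Qed.

Lemma childP a : a != omega -> child (par a) a.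
Proof. by move=> /has_parent[b c]; rewrite (par_child c). Qed.

Lemma child_omega b : ~ child b omega.
Proof.
by rewrite /child begin_omega => /esym/eqP; rewrite (negbTE (edge_end_root b)).
Qed.

Lemma edge_ind (P : edge T -> Prop) : P omega ->
  (forall b a, child b a -> P b -> P a) -> forall a, P a.
Proof.
move=> P0 PS a; move: {2}(depth a) (erefl (depth a)) => n.
elim: n a => [|n IH] a; first by move=> /depth0 ->.
have [->//|ne] := eqVneq a omega => d.
apply: (PS (par a)); [exact: childP|apply: IH].
by have := depth_child (childP ne); rewrite d => -[].
Qed.

Lemma finite_kids b : finite_set [set a | child b a].
Proof.
have fin := @tree_locally_finite T (edge_end b).
rewrite (_ : [set a | child b a] = [set a | child b a] `&`
    (@edge_end T) @^-1` [set y | adj (edge_end b) y]); last first.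
  apply/seteqP; split=> [a /= c|a []//]; split=> //=.
  by have [] := edgeP a; rewrite c.
have := @finite_preimage _ _ [set y | adj (edge_end b) y] (@edge_end T).
move=> /(_ (fun a a' _ _ => @edge_end_inj a a') fin).
by apply: sub_finite_set => a [].
Qed.

Definition kids b : seq (edge T) :=
  undup (sval (cid (proj1 (@finite_seqP _ _) (finite_kids b)))).

Lemma mem_kids b a : a \in kids b <-> child b a.
Proof.
rewrite /kids; case: cid => s /= /seteqP[s1 s2]; rewrite mem_undup; split.
  by move=> /s2.
by move=> /s1.
Qed.

Lemma kids_uniq b : uniq (kids b).
Proof. exact: undup_uniq. Qed.

Fixpoint level n : seq (edge T) :=
  if n is m.+1 then flatten [seq kids b | b <- level m] else [:: omega].

Lemma mem_level n a : (a \in level n) = (depth a == n).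
Proof.
elim: n a => [|n IH] a /=.
  rewrite inE; apply/eqP/eqP => [->|/depth0//]; exact: depth_omega.
apply/flatten_mapP/eqP => [[b]|d].
  by rewrite IH => /eqP <- /mem_kids/depth_child.
have ne : a != omega by apply: contra_eq_neq d => ->; rewrite depth_omega.
have c := childP ne; exists (par a); last exact/mem_kids.
by rewrite IH; have := depth_child c; rewrite d => -[->].
Qed.

Lemma level_uniq n : uniq (level n).
Proof.
elim: n => [//|n IH] /=; elim: (level n) IH => [//|b s IHs] /= /andP[bs us].
rewrite cat_uniq kids_uniq IHs // andbT /=.
apply/hasPn => a /flatten_mapP[b' b's /mem_kids c']; apply/negP => /= /mem_kids c.
by rewrite (child_inj c c') b's in bs.
Qed.

Lemma cylinderE a xi : cylinder a xi <-> edge_of_ray xi (depth a) = a.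
Proof.
have rx : is_ray (val xi) := set_mem (valP xi).
have geoxi n : geo (val xi n) = mkseq (fun i => val xi i.+1) n.
  by apply: geo_eq; [exact: rx.2|exact: last_ray].
split=> [[n e]|<-]; last by exists (depth a).+1.
apply: edge_end_inj; rewrite /edge_end /edge_of_ray /= -/(edge_end a) -e.
congr (val xi _); have := congr1 size (geo_edge a).
by rewrite -e geoxi size_mkseq size_rcons => ->.
Qed.

Lemma depth_ray xi n : depth (edge_of_ray xi n) = n.
Proof.
have rx : is_ray (val xi) := set_mem (valP xi).
rewrite /depth /edge_begin /=.
by rewrite (geo_eq (rx.2 n) (last_ray n rx)) size_mkseq.
Qed.

Lemma ray_edge_inj xi : injective (edge_of_ray xi).
Proof. by move=> n m /(congr1 depth); rewrite !depth_ray. Qed.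

Lemma cylinder_ray xi n : cylinder (edge_of_ray xi n) xi.
Proof. by apply/cylinderE; rewrite depth_ray. Qed.

Lemma child_ray xi n : child (edge_of_ray xi n) (edge_of_ray xi n.+1).
Proof. by []. Qed.

Lemma cylinder_disjoint a b xi : depth a = depth b ->
  cylinder a xi -> cylinder b xi -> a = b.
Proof. by move=> d /cylinderE <- /cylinderE <-; rewrite d. Qed.

Lemma cylinder_omega xi : cylinder omega xi.
Proof. by apply/cylinderE; apply: depth0; rewrite depth_ray depth_omega. Qed.

Lemma ray_of_edges (s : nat -> edge T) : s 0%N = omega ->
  (forall n, child (s n) (s n.+1)) ->
  exists xi : boundary T, forall n, edge_of_ray xi n = s n.
Proof.
move=> s0 sS; pose p n := geo (edge_begin (s n)).
have [//|n||rp Hp] := @geodesic_ray T p.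
- by rewrite /p s0 begin_omega geo_root.
- exact: geoP.
- by move=> n; exists (edge_end (s n)); rewrite /p sS geo_edge.
have H : is_ray (fun n => last (root T) (p n)) by split.
exists (exist (fun z => z \in [set z : nat -> T | is_ray z]) _ (mem_set H)) => n.
by apply: edge_ext; rewrite /edge_begin /edge_end /= /p last_geo // sS.
Qed.

Lemma cylinder_kids b xi : cylinder b xi <->
  exists2 a, a \in kids b & cylinder a xi.
Proof.
split=> [/cylinderE e|[a /mem_kids c /cylinderE e]].
  exists (edge_of_ray xi (depth b).+1); last exact: cylinder_ray.
  by apply/mem_kids; rewrite /child -{2}e.
apply/cylinderE; apply: (@child_inj _ _ a) => //; rewrite -e (depth_child c).
exact: child_ray.
Qed.

End TreeCombinatorics.

(** * Potentials, flows and columns *)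

Section SumsOverLevels.
Variables (R : realType) (T : rooted_tree).
Implicit Types (a b k : edge T) (f g h m : edge T -> R) (xi : boundary T).

(** The potential at the end of [a]: the edges [iter i par a] form the path from
    [a] back to the root edge. *)
Definition pot f a : R := \sum_(i < (depth a).+1) f (iter i (@par T) a).

Lemma pot_omega f : pot f (omega T) = f (omega T).
Proof. by rewrite /pot depth_omega big_ord1. Qed.

Lemma pot_child f b a : child b a -> pot f a = f a + pot f b.
Proof.
move=> c; rewrite /pot (depth_child c) big_ord_recl /=; congr (_ + _).
by apply: eq_bigr => i _; have := iterSr i (@par T) a; rewrite (par_child c) => <-.
Qed.

Lemma pot_ge0 f a : (forall k, 0 <= f k) -> 0 <= pot f a.
Proof. by move=> f0; apply: sumr_ge0. Qed.

Lemma pot_self f a : (forall k, 0 <= f k) -> f a <= pot f a.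
Proof.
by move=> f0; rewrite /pot big_ord_recl /= lerDl; apply: sumr_ge0.
Qed.

Lemma pot_ray f xi n : pot f (edge_of_ray xi n) = \sum_(i < n.+1) f (edge_of_ray xi i).
Proof.
elim: n => [|n IH].
  have e : edge_of_ray xi 0 = omega T by apply: depth0; rewrite depth_ray.
  by rewrite big_ord1 /= e pot_omega.
by rewrite [RHS]big_ord_recr -IH (pot_child _ (child_ray xi n)) addrC.
Qed.

Lemma pot_linear f g (s t : R) a :
  pot (fun k => s * f k + t * g k) a = s * pot f a + t * pot g a.
Proof. by rewrite /pot big_split /= -!mulr_sumr. Qed.

Definition flow m := forall b, m b = \sum_(a <- kids b) m a.

Lemma sum_level_succ f n :
  \sum_(a <- level T n.+1) f a = \sum_(b <- level T n) \sum_(a <- kids b) f a.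
Proof. by rewrite /= big_flatten big_map. Qed.

Lemma flow_level m n : flow m -> \sum_(a <- level T n) m a = m (omega T).
Proof.
move=> fm; elim: n => [|n IH]; first by rewrite /= big_seq1.
rewrite sum_level_succ -IH; apply: eq_bigr => b _; exact/esym/fm.
Qed.

(** Summation by parts along the tree: for a flow [m], the pairing of [f] with
    [m] over the first levels is the mean of the potential of [f] over the last
    of these levels. *)
Lemma flow_pairing f m n : flow m ->
  \sum_(i < n.+1) \sum_(a <- level T i) f a * m a =
  \sum_(a <- level T n) pot f a * m a.
Proof.
move=> fm; elim: n => [|n IH]; first by rewrite big_ord1 /= !big_seq1 pot_omega.
rewrite big_ord_recr /= -/(level T n.+1) IH !sum_level_succ -big_split /=.
apply: eq_bigr => b _; rewrite {1}fm mulr_sumr -big_split /=.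
rewrite big_seq [RHS]big_seq; apply: eq_bigr => a /mem_kids c.
by rewrite (pot_child _ c); ring.
Qed.

(** The left end of the column over [a] when the columns over the children of an
    edge are laid side by side from the left: the sum, along the path to [a], of
    the widths of the elder siblings. *)
Definition elder f a : R :=
  if a == omega T then 0
  else \sum_(k <- take (index a (kids (par a))) (kids (par a))) f k.

Definition left_end f a : R := pot (elder f) a.

Lemma left_omega f : left_end f (omega T) = 0.
Proof. by rewrite /left_end pot_omega /elder eqxx. Qed.

Lemma left_child f b a : child b a ->
  left_end f a = left_end f b + \sum_(k <- take (index a (kids b)) (kids b)) f k.
Proof.
move=> c; rewrite /left_end (pot_child _ c) addrC /elder (par_child c) ifN //.
by apply/eqP => e; subst a; exact: child_omega c.
Qed.

Lemma left_parent f b a : (forall k, 0 <= f k) -> flow f -> child b a ->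
  left_end f b <= left_end f a /\ left_end f a + f a <= left_end f b + f b.
Proof.
move=> f0 fm c; rewrite (left_child _ c); split.
  by rewrite lerDl; apply: sumr_ge0.
rewrite -addrA lerD2l (fm b).
have ak : a \in kids b by exact/mem_kids.
rewrite -{3}(cat_take_drop (index a (kids b)) (kids b)) big_cat /= lerD2l.
rewrite (drop_nth a) ?index_mem // big_cons nth_index // lerDl.
exact: sumr_ge0.
Qed.

Lemma left_sibling f b a k : (forall k, 0 <= f k) -> flow f ->
  child b a -> child b k -> (index a (kids b) < index k (kids b))%N ->
  left_end f a + f a <= left_end f k.
Proof.
move=> f0 fm ca ck lt; rewrite (left_child _ ca) (left_child _ ck) -addrA lerD2l.
have ak : a \in kids b by exact/mem_kids.
rewrite -(subnKC lt) takeD big_cat /= (take_nth a) ?index_mem //.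
by rewrite nth_index // big_rcons /= -addrA lerD2l lerDl; apply: sumr_ge0.
Qed.

Lemma left_bounds f a : (forall k, 0 <= f k) -> flow f ->
  0 <= left_end f a /\ left_end f a + f a <= f (omega T).
Proof.
move=> f0 fm; elim/edge_ind: a => [|b a c [h1 h2]].
  by rewrite left_omega add0r.
have [h3 h4] := left_parent f0 fm c; split; first exact: le_trans h3.
exact: le_trans h2.
Qed.

(** The paths to [a] and [a'] part at some edge, where they enter the columns of
    two siblings. *)
Lemma left_level f a a' : (forall k, 0 <= f k) -> flow f ->
  depth a = depth a' -> a != a' ->
  left_end f a + f a <= left_end f a' \/ left_end f a' + f a' <= left_end f a.
Proof.
move=> f0 fm; elim/edge_ind: a a' => [|b a c IH] a'.
  by rewrite depth_omega => /esym/depth0 ->; rewrite eqxx.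
move=> d ne; have ne' : a' != omega T.
  by apply: contra_eq_neq d => ->; rewrite depth_omega (depth_child c).
have c' := childP ne'; move: d; rewrite (depth_child c) (depth_child c') => -[d].
have [e|nb] := eqVneq b (par a').
  rewrite -e in c'; case: (ltngtP (index a (kids b)) (index a' (kids b))) => lt.
  - by left; apply: (left_sibling f0 fm c c').
  - by right; apply: (left_sibling f0 fm c' c).
  - by case/eqP: ne; apply: (index_inj a _ _ lt); exact/mem_kids.
have [h1 h2] := left_parent f0 fm c; have [h3 h4] := left_parent f0 fm c'.
by case: (IH _ d nb) => h; [left|right]; lra.
Qed.

End SumsOverLevels.

(** * Energies and potentials as limits over the levels *)

Section ErealSums.
Variables (R : realType) (T : rooted_tree).
Implicit Types (a b k : edge T) (f g h m : edge T -> R) (xi : boundary T).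

(** The edges of a finite set have bounded depth. *)
Lemma esum_by_depth (S : set (edge T)) f (L : nat -> seq (edge T)) :
  (forall n, uniq (L n)) ->
  (forall n a, a \in L n <-> S a /\ (depth a <= n)%N) ->
  (forall a, 0 <= f a) ->
  \esum_(a in S) (f a)%:E = ereal_sup (range (fun n => (\sum_(a <- L n) f a)%:E)).
Proof.
move=> uL mL f0; apply/eqP; rewrite eq_le; apply/andP; split.
  apply: ge_ereal_sup => _ [X [finX XS] <-].
  have [r rE] := proj1 (finite_seqP X) finX.
  pose n := \max_(a <- r) depth a.
  apply: le_trans (ereal_sup_ubound _) => /=; last by exists n.
  rewrite -sumEFin (fsbig_seq _ _ (uL n)).
  apply: lee_fsum_nneg_subset => //=; first exact: finite_seq.
  - move=> a; rewrite !inE => Xa; apply/mL; split; first exact: XS.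
    by rewrite rE in Xa; apply: leq_bigmax_seq.
  - by move=> a _; rewrite lee_fin.
apply: ge_ereal_sup => _ [n _ <-]; apply: esum_ge; exists [set` L n].
  by split; [exact: finite_seq|move=> a /mL[]].
by rewrite -sumEFin (fsbig_seq _ _ (uL n)).
Qed.

Definition ball n : seq (edge T) := flatten [seq level T i | i <- iota 0 n.+1].

Lemma mem_ball n a : (a \in ball n) = (depth a <= n)%N.
Proof.
apply/flatten_mapP/idP => [[i]|le].
  by rewrite mem_iota mem_level add0n ltnS => /= le /eqP ->.
by exists (depth a); rewrite ?mem_level // mem_iota add0n ltnS.
Qed.

Lemma ball_uniq n : uniq (ball n).
Proof.
rewrite /ball; elim: (iota _ _) (iota_uniq 0 n.+1) => [//|i s IH] /= /andP[si us].
rewrite cat_uniq level_uniq IH // andbT /=; apply/hasPn => a /flatten_mapP[j js].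
by rewrite /= !mem_level => /eqP ->; apply: contraNneq si => <-.
Qed.

Lemma sum_ball f n :
  \sum_(a <- ball n) f a = \sum_(i < n.+1) \sum_(a <- level T i) f a.
Proof.
by rewrite /ball big_flatten big_map -[iota 0 n.+1]/(index_iota 0 n.+1) big_mkord.
Qed.

Lemma esum_ball f : (forall a, 0 <= f a) ->
  \esum_(a in [set: edge T]) (f a)%:E =
  ereal_sup (range (fun n => (\sum_(a <- ball n) f a)%:E)).
Proof.
move=> f0; apply: esum_by_depth => //; first exact: ball_uniq.
by move=> n a; rewrite mem_ball; split=> [|[]].
Qed.

Lemma energy_leP f (M : R) :
  (energy f <= M%:E)%E <-> forall n, \sum_(a <- ball n) f a ^+ 2 <= M.
Proof.
rewrite /energy esum_ball; last by move=> a; exact: sqr_ge0.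
split=> [le n|le].
  by rewrite -lee_fin; apply: le_trans le; apply: ereal_sup_ubound; exists n.
by apply: ge_ereal_sup => _ [n _ <-]; rewrite lee_fin.
Qed.

Lemma ball_le_energy f n : ((\sum_(a <- ball n) f a ^+ 2)%:E <= energy f)%E.
Proof.
rewrite /energy esum_ball; last by move=> a; exact: sqr_ge0.
by apply: ereal_sup_ubound; exists n.
Qed.

Lemma energy_ge0 f : (0 <= energy f)%E.
Proof. by apply: esum_ge0 => a _; rewrite lee_fin sqr_ge0. Qed.

Lemma potential_sup f xi : (forall a, 0 <= f a) ->
  potential f xi = ereal_sup (range (fun n => (pot f (edge_of_ray xi n))%:E)).
Proof.
move=> f0; rewrite /potential.
rewrite (@esum_by_depth _ f (fun n => [seq edge_of_ray xi i | i <- iota 0 n.+1])) //.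
- congr (ereal_sup _); apply: (congr1 (fun u : nat -> \bar R => range u)).
  apply/funext => n; congr (_%:E).
  by rewrite big_map -[iota 0 n.+1]/(index_iota 0 n.+1) big_mkord pot_ray.
- by move=> n; rewrite map_inj_uniq ?iota_uniq //; exact: ray_edge_inj.
- move=> n a; split=> [/mapP[i]|[/cylinderE e le]].
    rewrite mem_iota add0n ltnS => /= le ->; rewrite depth_ray; split=> //.
    exact: cylinder_ray.
  by apply/mapP; exists (depth a); rewrite ?mem_iota ?add0n ?ltnS.
Qed.

Lemma pot_le_potential f xi n : (forall a, 0 <= f a) ->
  ((pot f (edge_of_ray xi n))%:E <= potential f xi)%E.
Proof. by move=> f0; rewrite potential_sup //; apply: ereal_sup_ubound; exists n. Qed.

Lemma lt_potential f xi (M : R) : (forall a, 0 <= f a) ->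
  (M%:E < potential f xi)%E -> exists n, M < pot f (edge_of_ray xi n).
Proof.
move=> f0; rewrite potential_sup // => /ereal_sup_gt[_ [n _ <-]].
by rewrite lte_fin; exists n.
Qed.

Lemma pot_ray_mono f xi n n' : (forall a, 0 <= f a) -> (n <= n')%N ->
  pot f (edge_of_ray xi n) <= pot f (edge_of_ray xi n').
Proof.
move=> f0 /subnK <-; elim: (n' - n)%N => [//|d IH]; apply: (le_trans IH).
by rewrite addSn (pot_child _ (child_ray xi _)) lerDr.
Qed.

Lemma edge_sq_le_energy f a : ((f a ^+ 2)%:E <= energy f)%E.
Proof.
apply: le_trans (ball_le_energy f (depth a)); rewrite lee_fin.
rewrite (bigD1_seq a) ?mem_ball ?leqnn ?ball_uniq //= lerDl.
by apply: sumr_ge0 => k _; exact: sqr_ge0.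
Qed.

(** An element of the closure is approached, uniformly on edges and in energy,
    from within the set; the energy bound is the weighted form
    [g^2 <= (1 + t) f^2 + (1 + 1/t) (f - g)^2] of the triangle inequality. *)
Lemma l2_closure_approx (F : set (edge T -> R)) f (c e : R) : l2_closure F f ->
  energy f = c%:E -> 0 < e ->
  exists g, [/\ F g, forall a, `|g a - f a| < e & (energy g <= (c + e)%:E)%E].
Proof.
move=> [_ cl] Ef e0.
have c0 : 0 <= c by rewrite -lee_fin -Ef energy_ge0.
have Sf n : \sum_(a <- ball n) f a ^+ 2 <= c by move: n; apply/energy_leP; rewrite Ef.
clear Ef.
pose t := e / (2 * (c + 1)).
have t0 : 0 < t by rewrite divr_gt0 // mulr_gt0 //; lra.
have tc : t * c <= e / 2.
  have E : t * (c + 1) = e / 2 by rewrite /t; field; lra.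
  by nra.
pose d := Num.min (e ^+ 2) (e / (2 * (1 + t^-1))).
have it0 : 0 < t^-1 by rewrite invr_gt0.
have d0 : 0 < d.
  by rewrite lt_min exprn_gt0 //= divr_gt0 // mulr_gt0 //; lra.
have [g Fg lt] := cl d d0; exists g; split=> //.
  move=> a; rewrite distrC -(@ltr_pXn2r _ 2) ?nnegrE // ?(ltW e0) //.
  rewrite real_normK ?num_real //.
  have := le_lt_trans (edge_sq_le_energy (fun a => f a - g a) a) lt.
  by rewrite lte_fin => /lt_le_trans; apply; rewrite ge_min lexx.
have dd : (1 + t^-1) * d <= e / 2.
  have : d <= e / (2 * (1 + t^-1)) by rewrite ge_min lexx orbT.
  have p : 0 < 1 + t^-1 by lra.
  move=> /(ler_wpM2l (ltW p)) /le_trans; apply.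
  by rewrite le_eqVlt; apply/orP; left; apply/eqP; field; apply/andP; split; lra.
apply/energy_leP => n.
apply: (@le_trans _ _ (\sum_(a <- ball n)
    ((1 + t) * f a ^+ 2 + (1 + t^-1) * (f a - g a) ^+ 2))).
  apply: ler_sum => a _; rewrite -subr_ge0.
  rewrite (_ : _ - _ = t^-1 * (t * f a + (f a - g a)) ^+ 2).
    by rewrite mulr_ge0 ?(ltW it0) ?sqr_ge0.
  by field; lra.
rewrite big_split /= -!mulr_sumr.
have h1 := Sf n.
have h2 : \sum_(a <- ball n) (f a - g a) ^+ 2 <= d.
  by move: n {h1}; apply/energy_leP; exact: ltW.
have t1 : 0 <= 1 + t by lra.
have t2 : 0 <= 1 + t^-1 by lra.
have := ler_wpM2l t1 h1; have := ler_wpM2l t2 h2; nra.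
Qed.

End ErealSums.

(** * Equilibrium functions *)

Section EquilibriumFunctions.
Variables (R : realType) (T : rooted_tree).
Implicit Types (a b k : edge T) (f g h m : edge T -> R) (xi : boundary T).
Implicit Types (A : set (boundary T)).

Lemma potential_ge1P f xi : (forall a, 0 <= f a) ->
  (1 <= potential f xi)%E <-> forall r, r < 1 -> exists n, r < pot f (edge_of_ray xi n).
Proof.
move=> f0; split=> [le r r1|H].
  by apply: lt_potential => //; apply: lt_le_trans le; rewrite lte_fin.
apply/lee_addgt0Pr => e e0; have [|n lt] := H (1 - e); first by rewrite ltrBlDr ltrDl.
apply: (@le_trans _ _ ((pot f (edge_of_ray xi n))%:E + e%:E)%E).
  by rewrite -EFinD lee_fin -lerBlDr ltW.
by apply: leeD => //; exact: pot_le_potential.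
Qed.

Lemma energyD f g h : (forall a, f a ^+ 2 + g a ^+ 2 <= h a ^+ 2) ->
  (energy f + energy g <= energy h)%E.
Proof.
move=> le; rewrite /energy -esumD; last 2 first.
- by move=> a _; rewrite lee_fin sqr_ge0.
- by move=> a _; rewrite lee_fin sqr_ge0.
by apply: le_esum => a _; rewrite -EFinD lee_fin.
Qed.

(** The increments, along the tree, of the truncated potential. *)
Definition truncate g a : R := Num.min (pot g a) 1 -
  (if a == omega T then 0 else Num.min (pot g (par a)) 1).

Lemma pot_truncate g a : pot (truncate g) a = Num.min (pot g a) 1.
Proof.
elim/edge_ind: a => [|b a c IH].
  by rewrite pot_omega /truncate eqxx subr0.
rewrite (pot_child _ c) IH /truncate (par_child c) ifN ?subrK //.
by apply/eqP => e; subst a; exact: child_omega c.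
Qed.

Lemma truncate_bounds g a : (forall a, 0 <= g a) -> 0 <= truncate g a <= g a.
Proof.
move=> g0; rewrite /truncate; have [->|ne] := eqVneq a (omega T).
  by rewrite subr0 pot_omega le_min g0 ler01 ge_min lexx.
have := pot_child g (childP ne); set p := pot g (par a) => ->.
have ga := g0 a; have p0 : 0 <= p by exact: pot_ge0.
rewrite !minEle; case: (leP (g a + p) 1) => h1; case: (leP p 1) => h2.
all: by apply/andP; split; lra.
Qed.

Lemma admissible_truncate A g : admissible A g -> admissible A (truncate g).
Proof.
move=> [Eg g0 Pg]; have tb a := truncate_bounds a g0.
split=> [|a|xi Ax]; last 1 first.
- apply/potential_ge1P => [a|r r1]; first by case/andP: (tb a).
  have [n lt] := proj1 (potential_ge1P xi g0) (Pg xi Ax) r r1.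
  by exists n; rewrite pot_truncate lt_min lt.
- apply: le_lt_trans Eg; apply: le_esum => a _; rewrite lee_fin.
  by case/andP: (tb a) => h0 h1; rewrite ler_sqr ?nnegrE.
- by case/andP: (tb a).
Qed.

(** Truncating an admissible function keeps it admissible and lowers its energy,
    so that a nearly optimal one is close to its truncation, whose potential is
    at most 1. *)
Lemma equilibrium_pot_le1 A f (c : R) a :
  equilibrium_function A f -> capacity R A = c%:E -> pot f a <= 1.
Proof.
move=> [cl Ef] cA; rewrite cA in Ef.
pose D : R := (depth a).+1%:R.
have D0 : 0 < D by rewrite ltr0n.
suff H e : 0 < e -> e <= 1 -> pot f a <= 1 + D * (2 * e).
  rewrite leNgt; apply/negP => lt1.
  pose e : R := Num.min 1 ((pot f a - 1) / (4 * D)).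
  have p0 : 0 < (pot f a - 1) / (4 * D).
    by rewrite divr_gt0 ?subr_gt0 // mulr_gt0.
  have e0 : 0 < e by rewrite lt_min ltr01.
  have := H e e0; rewrite ge_min lexx /= => /(_ isT).
  have : D * (2 * e) <= D * (2 * ((pot f a - 1) / (4 * D))).
    by rewrite ler_wpM2l ?(ltW D0) // ler_wpM2l // ge_min lexx orbT.
  have -> : D * (2 * ((pot f a - 1) / (4 * D))) = (pot f a - 1) / 2.
    by field; rewrite gt_eqF.
  by move=> h1 h2; clear -h1 h2 lt1; lra.
move=> e0 e1; have ee0 : 0 < e ^+ 2 by rewrite exprn_gt0.
(* The energy lost by truncation is at most [e ^+ 2], so that no edge loses more
   than [e]. *)
have [g [Ag gf Eg]] := l2_closure_approx cl Ef ee0.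
have [_ g0 _] := Ag; have tb k := truncate_bounds k g0.
have gt k : g k - truncate g k <= e.
  have [t0 t1] := andP (tb k).
  rewrite -(@ler_pXn2r _ 2) ?nnegrE ?subr_ge0 // ?(ltW e0) //.
  have le : (energy (truncate g) + energy (fun k => (g k - truncate g k)%R) <= energy g)%E.
    apply: energyD => j; have [s0 s1] := andP (tb j).
    by have := g0 j; clear -s0 s1; nra.
  have cle : (c%:E <= energy (truncate g))%E.
    by rewrite -cA; apply: ereal_inf_lbound; exists (truncate g) => //; exact: admissible_truncate.
  have := leeD cle (edge_sq_le_energy (fun k => (g k - truncate g k)%R) k).
  move=> /le_trans/(_ (le_trans le Eg)).
  by rewrite -EFinD lee_fin lerD2l.
have le k : f k <= truncate g k + 2 * e.
  have := gf k; rewrite ltr_norml => /andP[h1 h2].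
  have h3 : e ^+ 2 <= e by rewrite expr2 ler_piMl ?(ltW e0).
  by have := gt k; clear -h1 h2 h3; lra.
apply: (@le_trans _ _ (pot (truncate g) a + D * (2 * e))).
  rewrite /pot; apply: le_trans (ler_sum _ (fun i _ => le _)) _.
  by rewrite big_split /= sumr_const card_ord -(mulr_natl (2 * e)).
by rewrite pot_truncate lerD2r ge_min lexx orbT.
Qed.

Lemma pot_tilt g (s : R) a :
  pot (fun k => (1 + s) * g k - s * (k == omega T)%:R) a = (1 + s) * pot g a - s.
Proof.
elim/edge_ind: a => [|b a c IH]; first by rewrite !pot_omega eqxx mulr1.
have /negbTE ne : a != omega T by apply/eqP => e; subst a; exact: child_omega c.
by rewrite !(pot_child _ c) IH ne mulr0; ring.
Qed.

(** Perturbing an admissible [g] to [(1 + s) g - s 1_omega] keeps it admissible;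
    to first order in [s] its energy changes by [2 s (energy g - g omega)]. *)
Lemma equilibrium_root_le A f (c : R) :
  equilibrium_function A f -> capacity R A = c%:E -> f (omega T) <= c.
Proof.
move=> [cl Ef] cA; rewrite cA in Ef.
have c0 : 0 <= c by rewrite -lee_fin -Ef energy_ge0.
rewrite leNgt; apply/negP => lt.
(* The gain [2 s eta] outweighs the second-order term [s ^+ 2 <= s eta / 2] and
   the approximation error, which is of order [e = s eta / 4]. *)
pose eta : R := f (omega T) - c; have eta0 : 0 < eta by rewrite subr_gt0.
pose s : R := Num.min 1 eta / 2.
have s0 : 0 < s by rewrite divr_gt0 // lt_min ltr01.
have s1 : s <= 1 / 2 by rewrite ler_wpM2r ?invr_ge0 // ge_min lexx.
have s2 : s <= eta / 2 by rewrite ler_wpM2r ?invr_ge0 // ge_min lexx orbT.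
pose e : R := s * eta / 4.
have e0 : 0 < e by rewrite divr_gt0 // mulr_gt0.
have [g [[Eg g0 Pg] gf Egc]] := l2_closure_approx cl Ef e0.
have gw : f (omega T) - e <= g (omega T).
  by have := gf (omega T); rewrite ltr_norml => /andP[h _]; clear -h; lra.
pose g' k : R := (1 + s) * g k - s * (k == omega T)%:R.
have ef : f (omega T) = c + eta by rewrite /eta; ring.
have ee : e <= eta / 8 by clear -s0 s1 eta0; rewrite /e; nra.
have sg : s <= g (omega T).
  by move: gw; rewrite ef => gw'; clearbody e s eta; clear -gw' c0 s2 ee eta0; lra.
have g'0 k : 0 <= g' k.
  rewrite /g'; have [->|_] := eqVneq k; last first.
    by rewrite mulr0 subr0 mulr_ge0 //; clear -s0; lra.
  by rewrite mulr1; clear -sg s0; nra.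
have bnd : (energy g' <= ((1 + s) ^+ 2 * (c + e) - 2 * s * (1 + s) * g (omega T) + s ^+ 2)%:E)%E.
  apply/energy_leP => n.
  have w : omega T \in ball T n by rewrite mem_ball depth_omega.
  rewrite (bigD1_seq _ w (ball_uniq _ n)) /= {1}/g' eqxx mulr1.
  rewrite (eq_bigr (fun k => (1 + s) ^+ 2 * g k ^+ 2)); last first.
    by move=> k ne; rewrite /g' (negbTE ne) mulr0 subr0 exprMn.
  have := proj1 (energy_leP _ _) Egc n.
  rewrite (bigD1_seq _ w (ball_uniq _ n)) /= -mulr_sumr.
  move: (\sum_(_ <- _ | _) _) => S h.
  have := ler_wpM2l (sqr_ge0 (1 + s)) h; clear; nra.
have Ag' : admissible A g'.
  split=> //; first by apply: le_lt_trans bnd _; rewrite ltry.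
  move=> xi Ax; apply/potential_ge1P => // r r1.
  have [|n h] := proj1 (potential_ge1P xi g0) (Pg xi Ax) ((r + s) / (1 + s)).
    by rewrite ltr_pdivrMr; clear -r1 s0; lra.
  exists n; rewrite /g' pot_tilt; move: h; rewrite ltr_pdivrMr; last by clear -s0; lra.
  by clear; lra.
have : (c%:E <= energy g')%E by rewrite -cA; apply: ereal_inf_lbound; exists g'.
move=> /le_trans/(_ bnd); rewrite lee_fin.
clear bnd Ag' Pg Eg Egc Ef cA cl.
move=> h; have ee4 : 4 * e = s * eta by rewrite /e; field.
rewrite ef in gw.
have p : 0 <= 2 * s * (1 + s) by clear -s0; nra.
have gw2 := ler_wpM2l p gw.
have q1 : s ^+ 2 <= s * eta / 2 by clear -s2 s0; nra.
have q2 : 0 <= s ^+ 2 * c by rewrite mulr_ge0 ?sqr_ge0.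
have q0 : s ^+ 2 <= 1 / 4 by clear -s1 s0; nra.
have q3 : s ^+ 2 * e <= e / 4 by have := ler_wpM2r (ltW e0) q0; clear; lra.
have q4 : s * e <= e / 2 by clear -s1 s0 e0; nra.
have q5 : 0 <= s ^+ 2 * eta by rewrite mulr_ge0 ?sqr_ge0 ?(ltW eta0).
clearbody e s eta; clear -h gw2 q1 q2 q3 q4 q5 ee4 e0; lra.
Qed.

End EquilibriumFunctions.

(** * Squares in the plane *)

Section Squares.
Variable R : realType.
Implicit Types (Q : square R) (x y : R).

Lemma in_square Q x y : sq_set Q (x, y) <->
  (sq_left Q <= x <= sq_left Q + sq_side Q) /\
  (sq_bottom Q <= y <= sq_bottom Q + sq_side Q).
Proof. by rewrite /sq_set /sq_xrange /= !in_itv /=. Qed.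

Lemma nbhs_box (x y : R) (B : set (R * R)%type) : nbhs (x, y) B ->
  exists2 r : R, 0 < r &
    forall u v, `|u - x| < r -> `|v - y| < r -> B (u, v).
Proof.
move=> /nbhs_ballP[r r0 sub]; exists r => // u v hu hv; apply: sub.
by split; rewrite /= -ball_normE /= distrC.
Qed.

Lemma interior_square Q x y : (sq_set Q)° (x, y) ->
  (sq_left Q < x < sq_left Q + sq_side Q) /\
  (sq_bottom Q < y < sq_bottom Q + sq_side Q).
Proof.
move=> /nbhs_box[r r0 H].
have r2 : `|r / 2| < r by rewrite ger0_norm; lra.
have e1 z : `|z + r / 2 - z| < r by rewrite (addrC z) addrK.
have e2 z : `|z - r / 2 - z| < r by rewrite (addrC z) addrK normrN.
have [h1 h2] := proj1 (in_square _ _ _) (H _ _ (e1 x) (e1 y)).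
have [h3 h4] := proj1 (in_square _ _ _) (H _ _ (e2 x) (e2 y)).
by split; apply/andP; split; lra.
Qed.

Lemma square_interior Q x y : (sq_left Q < x < sq_left Q + sq_side Q) ->
  (sq_bottom Q < y < sq_bottom Q + sq_side Q) -> (sq_set Q)° (x, y).
Proof.
move=> /andP[h1 h2] /andP[h3 h4].
pose r : R := Num.min (Num.min (x - sq_left Q) (sq_left Q + sq_side Q - x))
  (Num.min (y - sq_bottom Q) (sq_bottom Q + sq_side Q - y)).
have r0 : 0 < r by rewrite !lt_min !subr_gt0 h1 h2 h3.
apply/nbhs_ballP; exists r => //= -[u v] [/=]; rewrite -!ball_normE /=.
rewrite !lt_min => /andP[/andP[h5 h6] _] /andP[_ /andP[h7 h8]].
move: h5 h6 h7 h8; rewrite !ltr_norml => /andP[a1 a2] /andP[a3 a4] /andP[a5 a6] /andP[a7 a8].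
by apply/in_square; split; apply/andP; split; lra.
Qed.

Lemma closed_box (a b c d : R) : closed (`[a, b] `*` `[c, d] : set (R * R)%type).
Proof.
have -> : (`[a, b] `*` `[c, d] : set (R * R)%type) =
    fst @^-1` `[a, b] `&` snd @^-1` `[c, d] by apply/seteqP; split.
apply: closedI; apply: closed_comp; try exact: interval_closed.
- by move=> z _; exact: cvg_fst.
- by move=> z _; exact: cvg_snd.
Qed.

End Squares.

(** * From a flow to a tiling *)

Section TilingFromFlow.
Variables (R : realType) (T : rooted_tree) (f : edge T -> R) (c : R).
Hypothesis f_ge0 : forall a, 0 <= f a.
Hypothesis f_flow : flow f.
Hypothesis f_root : f (omega T) = c.
Hypothesis f_pot : forall a, pot f a <= 1.
Hypothesis f_energy : energy f = c%:E.
Implicit Types (a b k : edge T).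

(** The squares on the path to [a] hang one under the other from the top of the
    rectangle, and reach down by [pot f a]. *)
Definition column_square a : square R :=
  Square (left_end f a) (1 - pot f a) (f_ge0 a).

Lemma column_prescribed : prescribed_by column_square.
Proof.
move=> a b c' [x y] /= []; rewrite /sq_xrange /= !in_itv /= => /andP[h1 h2] ->.
have [h3 h4] := left_parent f_ge0 f_flow c'; rewrite (pot_child _ c').
by split=> /=; [rewrite /sq_xrange /= in_itv /=; apply/andP; split; lra|ring].
Qed.

Lemma pot_iter_le a n : (n <= depth a)%N -> pot f (iter n (@par T) a) <= pot f a.
Proof.
elim: n a => [//|n IH] a le; rewrite iterSr.
have ne : a != omega T by apply: contraTneq le => ->; rewrite depth_omega.
have cp := childP ne; apply: (@le_trans _ _ (pot f (par a))).
  by apply: IH; rewrite (depth_child cp) in le.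
by rewrite (pot_child _ cp) lerDr.
Qed.

Lemma left_iter a n : (n <= depth a)%N ->
  left_end f (iter n (@par T) a) <= left_end f a /\
  left_end f a + f a <= left_end f (iter n (@par T) a) + f (iter n (@par T) a).
Proof.
elim: n a => [//|n IH] a le; rewrite iterSr.
have ne : a != omega T by apply: contraTneq le => ->; rewrite depth_omega.
have cp := childP ne; rewrite (depth_child cp) in le.
have [h1 h2] := IH _ le; have [h3 h4] := left_parent f_ge0 f_flow cp.
by split; [exact: le_trans h1 h3|exact: le_trans h4 h2].
Qed.

Lemma depth_iter a n : (n <= depth a)%N -> depth (iter n (@par T) a) = (depth a - n)%N.
Proof.
elim: n a => [|n IH] a le; first by rewrite subn0.
have ne : a != omega T by apply: contraTneq le => ->; rewrite depth_omega.
have cp := childP ne; rewrite (depth_child cp) in le *.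
by rewrite iterSr IH.
Qed.

(** On one path the squares hang one under the other; otherwise some ancestors of
    [a] and [b] on one level have columns side by side. *)
Lemma column_disjoint a b : a <> b ->
  (sq_set (column_square a))° `&` (sq_set (column_square b))° = set0.
Proof.
wlog le : a b / (depth a <= depth b)%N => [H|ne].
  have [/H//|/ltnW/H H' /nesym/H'] := leqP (depth a) (depth b).
  by rewrite setIC.
apply/seteqP; split=> // -[x y] [/interior_square/= [ax ay] /interior_square/= [bx byy]].
pose n := (depth b - depth a)%N.
have nb : (n <= depth b)%N by exact: leq_subr.
have da : depth (iter n (@par T) b) = depth a by rewrite depth_iter // subKn.
have [h1 h2] := left_iter nb.
have [e|ne'] := eqVneq a (iter n (@par T) b); last first.
  have := left_level f_ge0 f_flow (esym da) ne'; clear ne ne' da f_energy; move: ax ay bx byy.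
  by move=> /andP[a1 a2] _ /andP[a3 a4] _ [] h; lra.
case: n e nb {da h1 h2} => [//|n] e nb.
have neb : b != omega T by apply: contraTneq nb => ->; rewrite depth_omega.
have cp := childP neb.
have : pot f a <= pot f (par b).
  rewrite e iterSr; apply: pot_iter_le.
  by rewrite (depth_child cp) in nb.
move: ay byy; rewrite (pot_child _ cp) => /andP[a1 a2] /andP[a3 a4] h; clear ne neb e f_energy; lra.
Qed.

Lemma column_in_rectangle a : sq_set (column_square a) `<=` rectangle c.
Proof.
move=> [x y] /in_square/= [/andP[h1 h2] /andP[h3 h4]].
have [h5 h6] := left_bounds a f_ge0 f_flow; rewrite f_root in h6.
have h7 := f_pot a; have h8 := pot_self a f_ge0.
by split; rewrite /= in_itv /=; apply/andP; split; lra.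
Qed.

(** The columns over the children of an edge tile the column over the edge, so
    that the increments telescope. *)
Lemma growth_flow (phi : R -> R) :
  flow (fun a => phi (left_end f a + f a) - phi (left_end f a)).
Proof.
move=> b /=; set s := kids b.
pose F i := phi (left_end f b + \sum_(k <- take i s) f k).
have us : uniq s by exact: kids_uniq.
transitivity (\sum_(a <- s) (F (index a s).+1 - F (index a s))); last first.
  rewrite big_seq [RHS]big_seq; apply: eq_bigr => a ka.
  have cb := proj1 (mem_kids _ _) ka.
  rewrite /F (take_nth a) ?index_mem // nth_index // big_rcons /=.
  by rewrite (left_child _ cb) addrA.
rewrite (big_nth (omega T)) big_nat.
rewrite (eq_bigr (fun i => F i.+1 - F i)); last first.
  by move=> i /andP[_ lt]; rewrite index_uniq.
rewrite -big_nat telescope_sumr // /F take_size take0 big_nil addr0.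
by rewrite -f_flow.
Qed.

Lemma partial_energy n :
  \sum_(a <- ball T n) f a ^+ 2 = \sum_(a <- level T n) pot f a * f a.
Proof.
rewrite sum_ball -(flow_pairing f n f_flow).
by apply: eq_bigr => i _; apply: eq_bigr => a _; rewrite expr2.
Qed.

(** If an open box over ]u, v[ met no square, the potential would stay below
    [1 - y2] on the part of the flow that passes through ]u, v[, and the energy
    would be less than [c]. *)
Lemma column_dense (u v y1 y2 : R) : 0 <= u -> u < v -> v <= c ->
  0 <= y1 -> y1 < y2 -> y2 <= 1 ->
  exists a x y, [/\ u < x < v, y1 < y < y2 & sq_set (column_square a) (x, y)].
Proof.
move=> u0 uv vc y10 y12 y21; apply: contrapT => none.
(* [o a] is the width of the part of the column over [a] that lies over ]u, v[. *)
pose phi (x : R) : R := Num.max u (Num.min v x).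
pose o a : R := phi (left_end f a + f a) - phi (left_end f a).
have phiE x : phi x = if x <= u then u else if x <= v then x else v.
  rewrite /phi; case: (leP x u) => h1.
    by rewrite min_r ?max_l //; lra.
  by case: (leP x v) => h2; rewrite max_r //; lra.
have fo : flow o by exact: growth_flow.
have phiB x y : x <= y ->
    [/\ 0 <= phi y - phi x, phi y - phi x <= y - x & x = y \/ v <= x \/ y <= u ->
     phi y - phi x = 0].
  rewrite !phiE => xy; case: (leP x u) => h1; case: (leP x v) => h2;
  case: (leP y u) => h3; case: (leP y v) => h4.
  1-16: by split; [lra|lra|case=> [?|[?|?]] //; lra].
have fa a : left_end f a <= left_end f a + f a by rewrite lerDl.
have o0 a : 0 <= o a by have [] := phiB _ _ (fa a).
have of1 a : o a <= f a.
  by have [_ h _] := phiB _ _ (fa a); apply: le_trans h _; rewrite addrAC subrr add0r.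
have ov a : 0 < o a -> exists2 x, u < x < v & left_end f a <= x <= left_end f a + f a.
  move=> oa; pose l := Num.max u (left_end f a); pose r := Num.min v (left_end f a + f a).
  have lr : l < r.
    have [_ _ z] := phiB _ _ (fa a).
    rewrite gt_max !lt_min uv /= !ltNge -negb_or -negb_or; apply/negP => h.
    suff e : o a = 0 by rewrite e ltxx in oa.
    apply: z; have := f_ge0 a; move: h => /orP[|/orP[]] h h'; lra.
  have h1 : u <= l by rewrite le_max lexx.
  have h2 : left_end f a <= l by rewrite le_max lexx orbT.
  have h3 : r <= v by rewrite ge_min lexx.
  have h4 : r <= left_end f a + f a by rewrite ge_min lexx orbT.
  by exists ((l + r) / 2); apply/andP; split; lra.
have step a : 0 < o a -> y2 <= 1 - pot f a + f a -> pot f a <= 1 - y2.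
  move=> /ov[x xuv xa] top; rewrite leNgt; apply/negP => lt; apply: none.
  pose w : R := Num.max (1 - pot f a) y1.
  have h1 : 1 - pot f a <= w by rewrite le_max lexx.
  have h2 : y1 <= w by rewrite le_max lexx orbT.
  have h3 : w < y2 by rewrite gt_max y12 andbT; lra.
  exists a, x, ((w + y2) / 2); split=> //; first by apply/andP; split; lra.
  by apply/in_square; split=> //=; apply/andP; split; lra.
have low a : 0 < o a -> pot f a <= 1 - y2.
  elim/edge_ind: a => [|b a cb IH] oa.
    by apply: step => //; rewrite pot_omega; lra.
  apply: step => //; rewrite (pot_child _ cb).
  suff : pot f b <= 1 - y2 by lra.
  apply: IH; rewrite fo (bigD1_seq a) ?kids_uniq //=; last exact/mem_kids.
  by apply: ltr_pwDl => //; apply: sumr_ge0.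
have oc : o (omega T) = v - u.
  rewrite /o left_omega add0r f_root !phiE u0.
  by case: (leP c u) => h1; case: (leP c v) => h2; lra.
have : (energy f <= (c - y2 * (v - u))%:E)%E.
  apply/energy_leP => n; rewrite partial_energy -f_root -oc.
  rewrite -(flow_level n f_flow) -(flow_level n fo) mulr_sumr -sumrB.
  apply: ler_sum => a _; have [oa|] := ltP 0 (o a).
    have := low a oa; have := of1 a; have := f_ge0 a; clear -y10 y12; nra.
  have := o0 a => h1 h2; have -> : o a = 0 by apply/eqP; rewrite eq_le h1 h2.
  by rewrite mulr0 subr0 ler_piMl.
rewrite f_energy lee_fin; apply/negP; rewrite -ltNge ltrBlDr ltrDl.
by rewrite mulr_gt0 ?subr_gt0 // (le_lt_trans y10).
Qed.

Lemma column_tiling : 0 < c -> square_tiling column_square (rectangle c).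
Proof.
move=> c0; split; first by move=> a b; exact: column_disjoint.
apply/seteqP; split; last first.
  have cl : closed (rectangle c : set (R * R)%type) by exact: closed_box.
  move/closure_id: cl => ->; apply: closure_subset.
  by move=> z [a _]; exact: column_in_rectangle.
move=> [px py] [/=]; rewrite !in_itv /= => /andP[x0 xc] /andP[y0 y1].
move=> B /nbhs_box[r r0 HB].
pose u : R := Num.max 0 (px - r); pose v : R := Num.min c (px + r).
pose s : R := Num.max 0 (py - r); pose t : R := Num.min 1 (py + r).
have u1 : 0 <= u by rewrite le_max lexx.
have u2 : px - r <= u by rewrite le_max lexx orbT.
have v1 : v <= c by rewrite ge_min lexx.
have v2 : v <= px + r by rewrite ge_min lexx orbT.
have uv : u < v by rewrite gt_max !lt_min c0 /=; do 3 (try (apply/andP; split)); lra.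
have s1 : 0 <= s by rewrite le_max lexx.
have s2 : py - r <= s by rewrite le_max lexx orbT.
have t1 : t <= 1 by rewrite ge_min lexx.
have t2 : t <= py + r by rewrite ge_min lexx orbT.
have st : s < t by rewrite gt_max !lt_min ltr01 /=; do 3 (try (apply/andP; split)); lra.
have [a [x [y [/andP[h1 h2] /andP[h3 h4] Qa]]]] := column_dense u1 uv v1 s1 st t1.
exists (x, y); split; first by exists a.
by apply: HB; rewrite ltr_norml; apply/andP; split; lra.
Qed.

End TilingFromFlow.

(** * Tilings from equilibrium measures *)

Section CylinderMeasure.
Variables (R : realType) (T : rooted_tree).
Implicit Types (a b : edge T) (xi : boundary T).

Lemma open_boundaryP (U : set (boundary T)) : open U <->
  exists2 D : set (edge T), D `<=` setT & \bigcup_(a in D) cylinder a = U.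
Proof. by []. Qed.

Lemma open_cylinder a : open (cylinder a : set (boundary T)).
Proof. by apply/open_boundaryP; exists [set a] => //; rewrite bigcup_set1. Qed.

Lemma measurable_open (U : set (boundary T)) : open U ->
  measurable (U : set (borel_boundary T)).
Proof. by move=> oU; apply: sub_sigma_algebra. Qed.

Definition cylinders (s : seq (edge T)) : set (boundary T) :=
  \bigcup_(a in [set` s]) cylinder a.

Lemma cylinders_nil : cylinders [::] = set0.
Proof. by rewrite /cylinders bigcup_seq big_nil. Qed.

Lemma cylinders_cons a s : cylinders (a :: s) = cylinder a `|` cylinders s.
Proof. by rewrite /cylinders !bigcup_seq big_cons. Qed.

Lemma open_cylinders s : open (cylinders s).
Proof. by apply: bigcup_open => a _; exact: open_cylinder. Qed.

Lemma cylinders_kids b : cylinders (kids b) = cylinder b.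
Proof.
apply/seteqP; split=> xi => [[a ka ca]|/cylinder_kids[a ka ca]].
  by apply/cylinder_kids; exists a.
by exists a.
Qed.

Lemma measure_cylinders (mu : {measure set (borel_boundary T) -> \bar R})
  (s : seq (edge T)) n : uniq s -> (forall a, a \in s -> depth a = n) ->
  mu (cylinders s) = (\sum_(a <- s) mu (cylinder a))%E.
Proof.
move=> us ds; rewrite /cylinders measure_fin_bigcup.
- by rewrite -fsbig_seq.
- exact: finite_seq.
- apply/trivIsetP => a b /= sa sb /eqP ne; apply/seteqP; split=> // xi [ca cb].
  by case: ne; apply: (cylinder_disjoint _ ca cb); rewrite !ds.
- by move=> a _; apply: measurable_open; exact: open_cylinder.
Qed.

Lemma measure_flow (mu : {measure set (borel_boundary T) -> \bar R}) f :
  (forall a, mu (cylinder a) = (f a)%:E) -> flow f.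
Proof.
move=> muE b; apply: EFin_inj; rewrite -muE -cylinders_kids.
rewrite (@measure_cylinders mu _ (depth b).+1) ?kids_uniq //.
  by rewrite -sumEFin; apply: eq_bigr => a _.
by move=> a /mem_kids/depth_child.
Qed.

End CylinderMeasure.

(** The equilibrium function is a flow, being given by a measure, and has potential
    at most 1; so its energy [c] is at most its value at the root edge, and the
    two are equal. *)
Lemma equilibrium_tiling (R : realType) (T : rooted_tree) (A : set (boundary T))
    (mu : {measure set (borel_boundary T) -> \bar R}) :
  equilibrium_measure A mu -> (0 < capacity R A)%E ->
  exists Q : edge T -> square R,
    [/\ square_tiling Q (rectangle (fine (capacity R A))),
        prescribed_by Q &
        forall a, (sq_side (Q a))%:E = mu (cylinder a)].
Proof.
move=> [_ _ [f eqf muE]] cap0.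
have f0 a : 0 <= f a by rewrite -lee_fin -muE.
have ff : flow f := measure_flow muE.
pose c := fine (capacity R A).
have cE : capacity R A = c%:E.
  rewrite fineK // -eqf.2 ge0_fin_numE ?energy_ge0 //; exact: eqf.1.1.
have fp a : pot f a <= 1 := equilibrium_pot_le1 a eqf cE.
have fE : energy f = c%:E by rewrite eqf.2.
have fr : f (omega T) = c.
  apply/eqP; rewrite eq_le (equilibrium_root_le eqf cE) /= -lee_fin -fE.
  apply/energy_leP => n; rewrite (partial_energy ff) -(flow_level n ff).
  by apply: ler_sum => a _; rewrite ler_piMl.
exists (column_square f0); split=> //.
- apply: column_tiling => //; by rewrite -lte_fin -cE.
- exact: column_prescribed.
Qed.

(** * The measure of a flow *)

Section MeasureFromFlow.
Variables (R : realType) (T : rooted_tree) (m : edge T -> R).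
Hypothesis m_ge0 : forall a, 0 <= m a.
Hypothesis m_flow : flow m.
Implicit Types (a b k : edge T) (xi : boundary T) (x : R).

(** Columns are taken half-open, so that those over the children of an edge
    partition the column over the edge. *)
Definition column a : set R := `[left_end m a, left_end m a + m a[.

Lemma in_column a x : column a x <-> left_end m a <= x < left_end m a + m a.
Proof. by rewrite /column /= in_itv. Qed.

Lemma column_child b x : column b x -> exists2 k, child b k & column k x.
Proof.
move=> /in_column/andP[x0]; rewrite m_flow => x1.
pose F i := left_end m b + \sum_(k <- take i (kids b)) m k.
have H : exists i, x < F i by exists (size (kids b)); rewrite /F take_size.
case: (ex_minnP H) => -[|i] xi mi.
  by move: xi; rewrite /F take0 big_nil addr0 ltNge x0.
have lt : (i < size (kids b))%N.
  rewrite ltnNge; apply/negP => le.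
  have := mi i; rewrite /F take_oversize // x1 ltnn => /(_ isT).
  by [].
set k := nth (omega T) (kids b) i.
have kk : k \in kids b by exact: mem_nth.
have ck := proj1 (mem_kids _ _) kk.
exists k => //; apply/in_column; rewrite (left_child _ ck) index_uniq ?kids_uniq //.
apply/andP; split.
  by rewrite leNgt; apply/negP => /mi; rewrite ltnn.
by move: xi; rewrite /F (take_nth (omega T)) // big_rcons /= addrA.
Qed.

Lemma column_parent b a x : child b a -> column a x -> column b x.
Proof.
move=> c /in_column/andP[h1 h2]; have [h3 h4] := left_parent m_ge0 m_flow c.
by apply/in_column; apply/andP; split; [exact: le_trans h3 h1|exact: lt_le_trans h2 h4].
Qed.

Lemma column_root a x : column a x -> column (omega T) x.
Proof. by elim/edge_ind: a => [//|b a c IH] /(column_parent c). Qed.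

Lemma column_inj a b x : depth a = depth b -> column a x -> column b x -> a = b.
Proof.
move=> d /in_column/andP[h1 h2] /in_column/andP[h3 h4].
have [//|ne] := eqVneq a b.
by have := left_level m_ge0 m_flow d ne; clear ne d => -[] h; exfalso; lra.
Qed.

Lemma column_ray x : column (omega T) x ->
  exists xi : boundary T, forall n, column (edge_of_ray xi n) x.
Proof.
move=> x0; pose C := {a : edge T | column a x}.
have step (a : C) : {b : C | child (sval a) (sval b)}.
  case: a => a ca; have [k [ck kx]] := cid2 (column_child ca).
  by exists (exist _ k kx).
pose s n : C := iter n (fun a : C => sval (step a)) (exist _ (omega T) x0).
have [//|n|xi e] := @ray_of_edges T (fun n => sval (s n)).
  exact: (svalP (step (s n))).
by exists xi => n; rewrite e; exact: (svalP (s n)).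
Qed.

(** The ray through the columns above a point of the base; the default value is
    taken off the base, where the measure to be pushed forward vanishes. *)
Definition address x : boundary T :=
  if pselect (column (omega T) x) is left h then sval (cid (column_ray h)) else point.

Lemma address_column x a : column (omega T) x -> cylinder a (address x) <-> column a x.
Proof.
rewrite /address; case: pselect => // h _; case: cid => xi /= H; split.
  by move=> /cylinderE <-.
move=> ax; apply/cylinderE; apply: (column_inj _ (H _) ax); exact: depth_ray.
Qed.

Lemma measurable_address :
  measurable_fun [set: measurableTypeR R]
    (address : measurableTypeR R -> borel_boundary T).
Proof.
have mcol a : measurable (column a) by exact: measurable_itv.
have mcyl a : measurable (address @^-1` cylinder a).
  rewrite (_ : address @^-1` cylinder a =
    column a `|` (~` column (omega T) `&` [set _ | cylinder a (point : boundary T)])).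
    apply: measurableU => //; apply: measurableI; first exact: measurableC.
    have [h|h] := pselect (cylinder a (point : boundary T)).
      by rewrite (_ : [set _ | _] = setT) //; apply/seteqP; split.
    by rewrite (_ : [set _ | _] = set0) //; apply/seteqP; split.
  apply/seteqP; split=> x /=.
    have [h|h] := pselect (column (omega T) x).
      by move=> /(address_column _ h); left.
    by rewrite /address; case: pselect => // _ cp; right.
  move=> [cx|[h cp]]; first by apply/address_column => //; exact: column_root cx.
  by rewrite /address; case: pselect.
apply: (@measurability _ _ _ (borel_boundary T) setT address (@open (boundary T))) => //.
move=> _ [U /open_boundaryP[D _ <-] <-]; rewrite setTI.
rewrite (_ : \bigcup_(a in D) cylinder a =
    \bigcup_n cylinders [seq a <- level T n | a \in D]).
  rewrite preimage_bigcup; apply: bigcupT_measurable => n.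
  rewrite /cylinders preimage_bigcup; apply: fin_bigcup_measurable => //.
apply/seteqP; split=> xi.
  move=> [a Da ca]; exists (depth a) => //; exists a => //=.
  by rewrite mem_filter mem_set //= mem_level.
by move=> [n _ [a /= ]]; rewrite mem_filter => /andP[/set_mem Da _] ca; exists a.
Qed.

(** The measure is the image of Lebesgue measure on the base under [address]. *)
Lemma flow_measure : exists mu : {measure set (borel_boundary T) -> \bar R},
  forall a, mu (cylinder a) = (m a)%:E.
Proof.
have mcol : measurable (column (omega T)) by exact: measurable_itv.
pose leb : {measure set (measurableTypeR R) -> \bar R} := mrestr (@lebesgue_measure R) mcol.
pose phi : measurableTypeR R -> borel_boundary T := address.
unshelve refine (ex_intro _ (pushforward leb phi : {measure set _ -> \bar R}) _).
  exact: measurable_address.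
move=> a.
change (lebesgue_measure ((address @^-1` cylinder a) `&` column (omega T)) = (m a)%:E).
rewrite (_ : _ `&` _ = column a); last first.
  apply/seteqP; split=> x /=; first by move=> [+ cx] => /(address_column _ cx).
  by move=> cx; have c0 := column_root cx; split=> //; apply/address_column.
rewrite /column lebesgue_measure_itv /= lte_fin ltrDl.
case: ltP => [_|m0]; first by rewrite -EFinD addrAC subrr add0r.
by congr (_%:E); apply/eqP; rewrite eq_le m0 m_ge0.
Qed.

End MeasureFromFlow.

(** * Compactness of the boundary *)

Section BoundaryCompact.
Variable T : rooted_tree.
Implicit Types (a b k : edge T) (xi : boundary T).

(** An ultrafilter singles out one edge of each level, and converges to the ray
    through these edges. *)
Lemma boundary_compact : compact [set: boundary T].
Proof.
rewrite compact_ultra => F UF _.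
have seqF (s : seq (edge T)) : F (cylinders s) -> exists2 a, a \in s & F (cylinder a).
  elim: s => [|a s IH]; first by rewrite cylinders_nil => /filter_not_empty.
  rewrite cylinders_cons => Fas; have [Fa|Fa] := in_ultra_setVsetC (cylinder a) UF.
    by exists a; rewrite // mem_head.
  have [k ks Fk] : exists2 k, k \in s & F (cylinder k).
    by apply: IH; apply: filterS (filterI Fas Fa) => xi [[]].
  by exists k; rewrite // inE ks orbT.
pose C := {a : edge T | F (cylinder a)}.
have F0 : F (cylinder (omega T)).
  by apply: filterS filterT => xi _; exact: cylinder_omega.
have step (a : C) : {b : C | child (sval a) (sval b)}.
  case: a => a Fa; have := Fa; rewrite -cylinders_kids => /seqF/cid2[k /mem_kids ck Fk].
  by exists (exist _ k Fk).
pose s n : C := iter n (fun a : C => sval (step a)) (exist _ (omega T) F0).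
have [//|n|xi e] := @ray_of_edges T (fun n => sval (s n)).
  exact: (svalP (step (s n))).
exists xi; split=> // U; rewrite nbhsE => -[V [/open_boundaryP[D _ <-] [a Da ca]] VU].
apply: (@filterS _ F _ (cylinder a)); first by move=> eta ce; apply: VU; exists a.
move/cylinderE: ca => <-; rewrite e; exact: (svalP (s (depth a))).
Qed.

End BoundaryCompact.

(** * The set carried by a flow *)

Lemma small_fraction (R : realType) (c e : R) : 0 <= c -> 0 < e ->
  exists eta : R, [/\ 0 < eta, eta <= 1 & 2 * eta * c <= e].
Proof.
move=> c0 e0; pose q : R := e / (2 * (c + 1)); exists (Num.min 1 q).
have q0 : 0 < q by rewrite divr_gt0 // mulr_gt0 //; lra.
have h : q * (2 * (c + 1)) = e by rewrite /q; field; lra.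
have h' : Num.min 1 q <= q by rewrite ge_min lexx orbT.
split; [by rewrite lt_min ltr01|by rewrite ge_min lexx|].
by have := ler_wpM2r c0 h'; lra.
Qed.

Section EquilibriumFromFlow.
Variables (R : realType) (T : rooted_tree) (f : edge T -> R) (c : R).
Hypothesis f_ge0 : forall a, 0 <= f a.
Hypothesis f_flow : flow f.
Hypothesis f_root : f (omega T) = c.
Hypothesis f_pot : forall a, pot f a <= 1.
Hypothesis f_energy : energy f = c%:E.
Variable mu : {measure set (borel_boundary T) -> \bar R}.
Hypothesis muE : forall a, mu (cylinder a) = (f a)%:E.
Implicit Types (a b : edge T) (xi : boundary T) (U K : set (boundary T)).

Lemma measure_level (s : seq (edge T)) n : uniq s -> (forall a, a \in s -> depth a = n) ->
  mu (cylinders s) = (\sum_(a <- s) f a)%:E.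
Proof.
move=> us ds; rewrite (measure_cylinders mu us ds) -sumEFin.
by apply: eq_bigr => a _.
Qed.

Lemma filter_level (P : pred (edge T)) n :
  mu (cylinders [seq a <- level T n | P a]) = (\sum_(a <- level T n | P a) f a)%:E.
Proof.
rewrite (@measure_level _ n) ?filter_uniq ?level_uniq // ?big_filter //.
by move=> a; rewrite mem_filter mem_level => /andP[_ /eqP].
Qed.

(** The sums equal [c] minus the energy of [f] on the first levels. *)
Lemma level_tail (e : R) : 0 < e ->
  exists n, \sum_(a <- level T n) (1 - pot f a) * f a <= e.
Proof.
move=> e0; apply: contrapT => H.
have : (energy f <= (c - e)%:E)%E.
  apply/energy_leP => n; rewrite (partial_energy f_flow).
  have : ~ (\sum_(a <- level T n) (1 - pot f a) * f a <= e) by move=> h; apply: H; exists n.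
  move/negP; rewrite -ltNge -f_root -(flow_level n f_flow).
  rewrite (eq_bigr (fun a => f a - pot f a * f a)); last by move=> a _; ring.
  by rewrite sumrB; lra.
by rewrite f_energy lee_fin; apply/negP; rewrite -ltNge; lra.
Qed.

Lemma measure_low_level (e : R) n : 0 < e ->
  (mu (cylinders [seq a <- level T n | (pot f a < 1 - e)%R]) <=
   ((\sum_(a <- level T n) (1 - pot f a) * f a) / e)%R%:E)%E.
Proof.
move=> e0; rewrite filter_level lee_fin ler_pdivlMr // mulr_suml big_mkcond /=.
apply: ler_sum => a _; have p1 := f_pot a; have fa := f_ge0 a.
case: ifP => [lt|_]; last by rewrite mulr_ge0 // subr_ge0.
by rewrite mulrC ler_wpM2r //; lra.
Qed.

(** Off an open set of arbitrarily small measure the potential of [f] is at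
    least 1: the levels are chosen far enough that Chebyshev's inequality bounds
    the measure of the rays with potential below [1 - 1/(k+1)] by [d / 2^(k+1)]. *)
Lemma open_small_bad (d : R) : 0 < d -> exists U, [/\ open U, (mu U <= d%:E)%E &
  forall xi, ~ U xi -> (1 <= potential f xi)%E].
Proof.
move=> d0; pose e k : R := k.+1%:R^-1.
have e0 k : 0 < e k by rewrite invr_gt0 ltr0n.
have tail k : exists n, \sum_(a <- level T n) (1 - pot f a) * f a <= d / (2 ^ k.+1)%:R * e k.
  apply: level_tail; rewrite mulr_gt0 // divr_gt0 // ltr0n expn_gt0 //.
pose N k := sval (cid (tail k)).
pose V k := cylinders [seq a <- level T (N k) | pot f a < 1 - e k].
exists (\bigcup_k V k); split.
- by apply: bigcup_open => k _; exact: open_cylinders.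
- apply: (le_trans (measure_sigma_subadditive mu (F := V) _ _ _)) => //.
  + by move=> k; apply: measurable_open; exact: open_cylinders.
  + by apply: measurable_open; apply: bigcup_open => k _; exact: open_cylinders.
  apply: le_trans (epsilon_trick0 xpredT (ltW d0)).
  apply: lee_nneseries => // k _; apply: (le_trans (measure_low_level _ (e0 k))).
  by rewrite lee_fin ler_pdivrMr //; rewrite /N; case: cid.
- move=> xi nV; apply/potential_ge1P => // r r1.
  pose k := Num.truncn (1 - r)^-1.
  have lt : e k < 1 - r.
    rewrite /e -[X in _ < X]invrK ltf_pV2 ?posrE ?invr_gt0 ?ltr0n ?subr_gt0 //.
    exact: truncnS_gt.
  exists (N k); have := nV; rewrite ltNge => nV'; apply/negP => le; apply: nV.
  exists k => //; exists (edge_of_ray xi (N k)); last exact: cylinder_ray.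
  by rewrite /= mem_filter mem_level depth_ray eqxx andbT; lra.
Qed.

(** Pairing an admissible [g] with the flow [f]: the potential of [g] is nearly 1
    on all but a small part of a deep level, while by summation by parts and
    [2 g f <= g^2 + f^2] its mean is at most [(energy g + c) / 2]. *)
Lemma energy_lower_bound U g (d : R) : open U -> (mu U <= d%:E)%E ->
  admissible (~` U) g -> ((c - 2 * d)%:E <= energy g)%E.
Proof.
move=> oU mU [Eg g0 Pg].
suff H (e : R) : 0 < e -> ((c - 2 * d)%:E <= energy g + e%:E)%E.
  by apply/lee_addgt0Pr => e; exact: H.
move=> e0.
have c0 : 0 <= c by rewrite -f_root.
have d0 : 0 <= d by rewrite -lee_fin; apply: le_trans mU.
have [eta [eta0 eta1 etac]] := small_fraction c0 e0.
pose V n := cylinders [seq a <- level T n | 1 - eta < pot g a].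
have VP n xi : V n xi <-> 1 - eta < pot g (edge_of_ray xi n).
  split=> [[a /=]|lt]; last first.
    exists (edge_of_ray xi n); last exact: cylinder_ray.
    by rewrite /= mem_filter lt mem_level depth_ray eqxx.
  rewrite mem_filter mem_level => /andP[lt /eqP <-] /cylinderE e'.
  by rewrite e'.
have [n Vn] : exists n, ~` U `<=` V n.
  have : compact (~` U).
    exact: (subclosed_compact (open_closedC oU) (@boundary_compact T) (@subsetT _ _)).
  rewrite compact_cover => /(_ nat setT V).
  case=> [n _|xi nU|D _ cov]; first exact: open_cylinders.
    have [|n lt] := proj1 (potential_ge1P xi g0) (Pg xi nU) (1 - eta); first by lra.
    by exists n => //; apply/VP.
  exists (\max_(i <- finmap.enum_fset D) i)%N => xi /cov[i /= iD /VP lt]; apply/VP.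
  apply: lt_le_trans lt _; apply: pot_ray_mono => //.
  exact: (@leq_bigmax_seq nat (finmap.enum_fset D) xpredT id i iD isT).
have bad : \sum_(a <- level T n | ~~ (1 - eta < pot g a)) f a <= d.
  rewrite -lee_fin -filter_level; apply: le_trans mU; apply: le_measure.
  - by rewrite inE; apply: measurable_open; exact: open_cylinders.
  - by rewrite inE; exact: measurable_open.
  move=> xi [a /=]; rewrite mem_filter mem_level => /andP[nlt /eqP da] /cylinderE ca.
  apply: contrapT => /Vn/VP; rewrite -da ca; exact/negP.
have tot := flow_level n f_flow; rewrite f_root (bigID (fun a => 1 - eta < pot g a)) /= in tot.
have good : (1 - eta) * (c - d) <= \sum_(a <- level T n) pot g a * f a.
  have h : (1 - eta) * \sum_(a <- level T n | 1 - eta < pot g a) f a <=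
      \sum_(a <- level T n) pot g a * f a.
    rewrite mulr_sumr big_mkcond; apply: ler_sum => a _.
    case: ifP => [lt|_]; first by rewrite ler_wpM2r // ltW.
    by rewrite mulr_ge0 // pot_ge0.
  apply: le_trans h; rewrite ler_wpM2l ?subr_ge0 //.
  by lra.
have half : \sum_(a <- level T n) pot g a * f a <=
    (\sum_(a <- ball T n) g a ^+ 2 + c) / 2.
  rewrite -flow_pairing // -sum_ball.
  have h : \sum_(a <- ball T n) f a ^+ 2 <= c.
    by move: n {Vn bad tot good}; apply/energy_leP; rewrite f_energy.
  apply: (@le_trans _ _ ((\sum_(a <- ball T n) g a ^+ 2 + \sum_(a <- ball T n) f a ^+ 2) / 2)).
    rewrite -big_split mulr_suml; apply: ler_sum => a _ /=.
    by have := sqr_ge0 (g a - f a); lra.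
  by lra.
apply: le_trans (leeD (ball_le_energy g n) (lexx e%:E)).
rewrite -EFinD lee_fin.
have := ler_wpM2l (ltW eta0) d0; lra.
Qed.

Lemma capacity_mono (A B : set (boundary T)) : A `<=` B -> (capacity R A <= capacity R B)%E.
Proof.
move=> AB; apply: ereal_inf_le_tmp => _ [g [Eg g0 Pg] <-].
by exists g => //; split=> // xi /AB; exact: Pg.
Qed.

Lemma capacity_le_energy (A : set (boundary T)) g (M : R) : (forall a, 0 <= g a) ->
  (energy g <= M%:E)%E -> (forall xi, A xi -> (1 <= potential g xi)%E) ->
  (capacity R A <= M%:E)%E.
Proof.
move=> g0 Eg Pg; apply: (le_trans _ Eg); apply: ereal_inf_lbound; exists g => //.
by split=> //; apply: le_lt_trans Eg _; rewrite ltry.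
Qed.

(** Scaling [f] by [1 + e] makes it admissible on the open set where its potential
    exceeds [1 / (1 + e)]. *)
Lemma open_superset (A : set (boundary T)) (e : R) : 0 < e ->
  (forall xi, A xi -> (1 <= potential f xi)%E) ->
  exists G, [/\ open G, A `<=` G & (capacity R G <= ((1 + e) ^+ 2 * c)%:E)%E].
Proof.
move=> e0 PA; pose r : R := (1 + e)^-1.
have e1 : 0 < 1 + e by lra.
have r1 : r < 1 by rewrite invf_lt1 //; lra.
exists (\bigcup_n cylinders [seq a <- level T n | r < pot f a]); split.
- by apply: bigcup_open => n _; exact: open_cylinders.
- move=> xi /PA/potential_ge1P-/(_ f_ge0 r r1)[n lt]; exists n => //.
  exists (edge_of_ray xi n); last exact: cylinder_ray.
  by rewrite /= mem_filter lt mem_level depth_ray eqxx.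
have g0 a : 0 <= (1 + e) * f a + 0 * f a by rewrite mul0r addr0 mulr_ge0 // ltW.
apply: (@capacity_le_energy _ (fun a => (1 + e) * f a + 0 * f a)) => //.
  apply/energy_leP => n.
  rewrite (eq_bigr (fun a => (1 + e) ^+ 2 * f a ^+ 2)); last by move=> a _; ring.
  rewrite -mulr_sumr ler_wpM2l ?sqr_ge0 //.
  by move: n; apply/energy_leP; rewrite f_energy.
move=> xi [n _ [a /=]]; rewrite mem_filter mem_level => /andP[lt /eqP da] /cylinderE ca.
apply: le_trans (pot_le_potential xi n g0); rewrite lee_fin -da ca.
by have := ler_wpM2l (ltW e1) (ltW lt); rewrite /r mulfV ?lt0r_neq0 // pot_linear mul0r addr0.
Qed.

(** The set is the union of the complements of open sets of measure at most
    [1/(j+1)] off which the potential of [f] is at least 1. On it [f] is admissible,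
    which bounds the capacity by [c]; these complements are compact and have
    capacity at least [c - 2/(j+1)]. *)
Lemma equilibrium_of_flow : exists A : set (boundary T),
  [/\ Fsigma A, equilibrium_measure A mu & capacity R A = c%:E].
Proof.
pose d j : R := j.+1%:R^-1.
have d0 j : 0 < d j by rewrite invr_gt0 ltr0n.
have small (e : R) : 0 < e -> exists j, d j <= e.
  move=> e0; exists (Num.truncn e^-1).
  rewrite /d -[X in _ <= X]invrK lef_pV2 ?posrE ?invr_gt0 ?ltr0n //.
  exact/ltW/truncnS_gt.
have [U UP] := choice (fun j => open_small_bad (d0 j)).
pose A := \bigcup_j ~` U j.
have KA j : ~` U j `<=` A by move=> xi h; exists j.
have clK j : closed (~` U j) by apply: open_closedC; have [] := UP j.
have PA xi : A xi -> (1 <= potential f xi)%E.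
  by move=> [j _]; have [_ _] := UP j; apply.
have capK j : ((c - 2 * d j)%:E <= capacity R (~` U j))%E.
  have [oU mU _] := UP j; apply: le_ereal_inf_tmp => _ [g Ag <-].
  exact: (energy_lower_bound oU mU Ag).
have lim (x : \bar R) : (forall j, (c - 2 * d j)%:E <= x)%E -> (c%:E <= x)%E.
  move=> H; apply/lee_addgt0Pr => e e0.
  have [|j dj] := small (e / 2); first by rewrite divr_gt0.
  apply: le_trans (leeD (H j) (lexx e%:E)); rewrite -EFinD lee_fin.
  move: dj; rewrite ler_pdivlMr //; lra.
have capA : capacity R A = c%:E.
  apply/eqP; rewrite eq_le; apply/andP; split.
    by apply: (@capacity_le_energy _ f) => //; rewrite f_energy.
  by apply: lim => j; apply: le_trans (capK j) (capacity_mono (KA j)).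
exists A; split=> //; first by exists (fun j => ~` U j).
split.
- split; rewrite capA; apply/eqP; rewrite eq_le; apply/andP; split.
  + apply: lim => j; apply: le_trans (capK j) _; apply: ereal_sup_ubound.
    exists (~` U j) => //; split; last exact: KA.
    exact: (subclosed_compact (clK j) (@boundary_compact T) (@subsetT _ _)).
  + by apply: ge_ereal_sup => _ [K [_ sub] <-]; rewrite -capA; exact: capacity_mono.
  + by apply: le_ereal_inf_tmp => _ [G [_ sub] <-]; rewrite -capA; exact: capacity_mono.
  + apply/lee_addgt0Pr => e e0.
    have c0 : 0 <= c by rewrite -f_root.
    have [h [h0 h1 hc]] := small_fraction c0 (divr_gt0 e0 (ltr0n _ 2)).
    have [G [oG AG cG]] := open_superset h0 PA.
    apply: (@le_trans _ _ (capacity R G)); first by apply: ereal_inf_lbound; exists G.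
    apply: le_trans cG _; rewrite -EFinD lee_fin.
    have hh : h * (h * c) <= 1 * (h * c) by rewrite ler_wpM2r // mulr_ge0 // ltW.
    lra.
- have mC : measurable (~` closure A : set (borel_boundary T)).
    by apply: measurable_open; apply: closed_openC; exact: closed_closure.
  apply/eqP; rewrite eq_le measure_ge0 andbT; apply/lee_addgt0Pr => e e0; rewrite add0e.
  have [j dj] := small e e0; have [oU mU _] := UP j.
  apply: (@le_trans _ _ (d j)%:E); last by rewrite lee_fin.
  apply: le_trans mU; apply: le_measure; rewrite ?inE //; first exact: measurable_open.
  by move=> xi nA; apply: contrapT => nU; apply: nA; apply: subset_closure; exact: (KA j).
- exists f; last exact: muE.
  split; last by rewrite capA f_energy.
  split; first by rewrite f_energy ltry.
  move=> e e0; exists f; first by split=> //; rewrite f_energy ltry.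
  apply: (@le_lt_trans _ _ 0%:E); last by rewrite lte_fin.
  by apply/energy_leP => n; rewrite big1 // => a _; rewrite subrr expr0n.
Qed.

End EquilibriumFromFlow.

(** * From a tiling to a flow *)

Section FlowFromTiling.
Variables (R : realType) (T : rooted_tree) (c : R) (Q : edge T -> square R).
Hypothesis c_gt0 : 0 < c.
Hypothesis tiling : square_tiling Q (rectangle c).
Hypothesis prescribed : prescribed_by Q.
Hypothesis covers : covers_ae Q (rectangle c).
Hypothesis bottom_gt0 : forall a, 0 < sq_side (Q a) -> 0 < sq_bottom (Q a).
Implicit Types (a b k : edge T).

Let s a : R := sq_side (Q a).
Let l a : R := sq_left (Q a).
Let bot a : R := sq_bottom (Q a).

Let s_ge0 a : 0 <= s a. Proof. exact: sq_side_ge0. Qed.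

Lemma square_bounds a : [/\ 0 <= l a, l a + s a <= c, 0 <= bot a & bot a + s a <= 1].
Proof.
have [_ E] := tiling; have sub z : sq_set (Q a) z -> rectangle c z.
  by move=> Qz; rewrite E; apply: subset_closure; exists a.
have sa := s_ge0 a; have [] : rectangle c (l a, bot a) /\ rectangle c (l a + s a, bot a + s a).
  by split; apply: sub; apply/in_square; rewrite -/(l a) -/(bot a) -/(s a); split;
    apply/andP; split; lra.
move=> [/= + +] [/= + +]; rewrite !in_itv /=.
by move=> /andP[h1 h2] /andP[h3 h4] /andP[h5 h6] /andP[h7 h8]; split.
Qed.

Lemma square_child b a : child b a ->
  [/\ l b <= l a, l a + s a <= l b + s b & bot a + s a = bot b].
Proof.
move=> ch; have sub := prescribed ch; have sa := s_ge0 a.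
have [h1 h2] : lower_side (Q b) (l a, bot a + s a) /\
    lower_side (Q b) (l a + s a, bot a + s a).
  by split; apply: sub; split=> //; rewrite /sq_xrange /= in_itv /= -/(l a) -/(s a);
    apply/andP; split; lra.
move: h1 h2 => [/= + e] [/= + _]; rewrite /sq_xrange /= !in_itv /=.
by move=> /andP[h1 h2] /andP[h3 h4]; split.
Qed.

Lemma square_root a :
  [/\ l (omega T) <= l a, l a + s a <= l (omega T) + s (omega T) &
      bot a + s a <= bot (omega T) + s (omega T)].
Proof.
elim/edge_ind: a => [//|b a /square_child[h1 h2 h3] [h4 h5 h6]].
by have := s_ge0 b; split; lra.
Qed.

(** All squares lie below the root square and in its column, so the root square
    has the full width and touches the top. *)
Lemma root_square : [/\ l (omega T) = 0, s (omega T) = c & bot (omega T) = 1 - c].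
Proof.
have [_ E] := tiling; set w := omega T.
have sub : rectangle c `<=` `[l w, l w + s w] `*` `[0, bot w + s w].
  rewrite E; have := @closed_box R (l w) (l w + s w) 0 (bot w + s w).
  move/closure_id => ->; apply: closure_subset => -[x y] [a _ /in_square].
  rewrite -/(l a) -/(bot a) -/(s a) => -[/andP[h1 h2] /andP[h3 h4]].
  have [h5 h6 h7] := square_root a; have [_ _ h8 _] := square_bounds a.
  by split; rewrite /= in_itv /=; apply/andP; split; lra.
have [h1 h2 h3 h4] := square_bounds w.
have [|/= h5 _] := sub (0, 0); first by split; rewrite /= in_itv /= ?lexx ?ler01 ?ltW.
have [|/= h6 h7] := sub (c, 1); first by split; rewrite /= in_itv /= ?lexx ?ler01 ?ltW.
by move: h5 h6 h7; rewrite !in_itv /= => /andP[h5 _] /andP[_ h6] /andP[_ h7]; split; lra.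
Qed.

Lemma bottom_pot a : bot a = 1 - pot s a.
Proof.
elim/edge_ind: a => [|b a ch IH].
  by have [_ h1 h2] := root_square; rewrite pot_omega h2 -h1.
by have [_ _ h] := square_child ch; rewrite (pot_child _ ch); lra.
Qed.

Lemma tiling_pot_le1 a : pot s a <= 1.
Proof. by have [_ _ h _] := square_bounds a; have := bottom_pot a; lra. Qed.

(** The squares of two siblings hang from the same height, so that overlapping
    sides force overlapping interiors. *)
Lemma siblings_disjoint b k k' x : child b k -> child b k' -> k <> k' ->
  l k < x < l k + s k -> l k' < x < l k' + s k' -> False.
Proof.
move=> ck ck' ne /[dup] /andP[h1 h2] xk /[dup] /andP[h3 h4] xk'.
have [_ _ e] := square_child ck; have [_ _ e'] := square_child ck'.
pose r : R := Num.min (s k) (s k') / 2.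
have r0 : 0 < r by rewrite divr_gt0 // lt_min; apply/andP; split; lra.
have r1 : r <= s k / 2 by rewrite ler_wpM2r ?invr_ge0 // ge_min lexx.
have r2 : r <= s k' / 2 by rewrite ler_wpM2r ?invr_ge0 // ge_min lexx orbT.
have [disj _] := tiling; have := disj _ _ ne => /seteqP[+ _].
move=> /(_ (x, bot b - r)); apply; split; apply: square_interior => //.
  by rewrite -/(bot k) -/(s k); apply/andP; split; lra.
by rewrite -/(bot k') -/(s k'); apply/andP; split; lra.
Qed.

(** The upper sides of the children are segments of the lower side of [b] that do
    not overlap. *)
Lemma kids_packing b : \sum_(k <- kids b) s k <= s b.
Proof.
pose I k := `]l k, l k + s k[%classic.
have mI k : measurable (I k) by exact: measurable_itv.
have leb (u v : R) : 0 <= v -> lebesgue_measure `]u, u + v[%classic = v%:E.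
  move=> v0; rewrite lebesgue_measure_itv /= lte_fin ltrDl.
  case: ltP => [_|v1]; first by rewrite -EFinD addrAC subrr add0r.
  by congr (_%:E); apply/eqP; rewrite eq_le v0 v1.
rewrite -lee_fin -sumEFin -(leb (l b) (s b)) //.
rewrite (eq_bigr (fun k => lebesgue_measure (I k))); last by move=> k _; rewrite leb.
rewrite (fsbig_seq _ _ (kids_uniq b)) -(measure_fin_bigcup lebesgue_measure) //.
- apply: le_measure; rewrite ?inE //.
    by apply: fin_bigcup_measurable => // k _; exact: mI.
  move=> x [k /= /mem_kids ck]; rewrite /I /= !in_itv /= => /andP[h1 h2].
  by have [h3 h4 _] := square_child ck; apply/andP; split; lra.
- apply/trivIsetP => k k' /= /mem_kids ck /mem_kids ck' /eqP ne.
  apply/seteqP; split=> // x []; rewrite /I /= !in_itv /=.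
  exact: siblings_disjoint ck ck' ne.
- by move=> k _; exact: mI.
Qed.

(** The squares cover almost all of the rectangle, so that their areas add up to
    at least [c]. *)
Lemma area_bound (M : R) : (forall n, \sum_(a <- ball T n) s a ^+ 2 <= M) -> c <= M.
Proof.
move=> HM; pose area := (@lebesgue_measure R \x @lebesgue_measure R)%E.
have len (u v w : R) : v = u + w -> 0 <= w -> lebesgue_measure `[u, v]%classic = w%:E.
  move=> -> w0; rewrite lebesgue_measure_itv /= lte_fin ltrDl.
  case: ltP => [_|w1]; first by rewrite -EFinD addrAC subrr add0r.
  by congr (_%:E); apply/eqP; rewrite eq_le w0 w1.
pose V n := \bigcup_(a in [set` level T n]) sq_set (Q a).
have mQ a : measurable (sq_set (Q a)) by apply: measurableX; exact: measurable_itv.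
have mV n : measurable (V n) by apply: fin_bigcup_measurable => // a _; exact: mQ.
have mU : measurable (\bigcup_n V n) by exact: bigcupT_measurable.
have mR : measurable (rectangle c) by apply: measurableX; exact: measurable_itv.
have UE : \bigcup_a sq_set (Q a) = \bigcup_n V n.
  apply/seteqP; split=> z.
    by move=> [a _ Qa]; exists (depth a) => //; exists a; rewrite //= mem_level.
  by move=> [n _ [a _ Qa]]; exists a.
have Qarea a : area (sq_set (Q a)) = (s a ^+ 2)%:E.
  rewrite /area product_measure1E; try exact: measurable_itv.
  by rewrite expr2 EFinM; congr (_ * _)%E; exact: len.
have Rarea : area (rectangle c) = c%:E.
  rewrite /area product_measure1E; try exact: measurable_itv.
  by rewrite -[RHS]mule1; congr (_ * _)%E; apply: len; rewrite ?add0r ?ltW.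
have Varea n : (area (V n) <= (\sum_(a <- level T n) s a ^+ 2)%:E)%E.
  rewrite -sumEFin (eq_bigr (fun a => area (sq_set (Q a)))); last by move=> a _; rewrite Qarea.
  rewrite (fsbig_seq _ _ (level_uniq T n)).
  by apply: content_sub_fsum; [exact: finite_seq|move=> a _; exact: mQ|exact: mV|].
have Uarea : (area (\bigcup_n V n) <= M%:E)%E.
  apply: (le_trans (measure_sigma_subadditive area (F := V) mV mU _)) => //.
  apply: lime_le; first by apply: is_cvg_nneseries => n _ _; exact: measure_ge0.
  apply: nearW => n; case: n => [|n].
    rewrite big_geq // lee_fin; apply: le_trans (HM 0%N).
    by apply: sumr_ge0 => a _; exact: sqr_ge0.
  apply: le_trans (lee_sum _ (fun i _ => Varea i)) _.
  by rewrite sumEFin lee_fin big_mkord -sum_ball.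
set U := \bigcup_n V n in mU UE Uarea *.
have split_area : (area (rectangle c) <= area (rectangle c `&` U) + area (rectangle c `\` U))%E.
  rewrite -{1}(setUIDK (rectangle c) U).
  by apply: measureU2; [exact: measurableI|exact: measurableD].
have null : area (rectangle c `\` U) = 0%E by rewrite -UE.
rewrite -lee_fin -Rarea; apply: le_trans split_area _; rewrite null adde0.
apply: le_trans Uarea; apply: le_measure; rewrite ?inE //.
exact: measurableI.
Qed.

Let deficit a : R := s a - \sum_(k <- kids a) s k.

(** Slicing the rectangle at the bottoms of the squares of one level: what lies
    under these squares is divided among the squares of the next level, what lies
    under them, and the part under the deficits. *)
Lemma area_balance n :
  \sum_(a <- ball T n) s a ^+ 2 +
  \sum_(i < n) \sum_(a <- level T i) (1 - pot s a) * deficit a +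
  \sum_(a <- level T n) (1 - pot s a) * s a = s (omega T).
Proof.
elim: n => [|n IH].
  by rewrite sum_ball big_ord1 big_ord0 /= !big_seq1 pot_omega; ring.
have step : \sum_(a <- level T n) (1 - pot s a) * s a =
    \sum_(a <- level T n) (1 - pot s a) * deficit a +
    \sum_(a <- level T n.+1) s a ^+ 2 +
    \sum_(a <- level T n.+1) (1 - pot s a) * s a.
  rewrite -addrA !sum_level_succ -!big_split /=; apply: eq_bigr => b _.
  rewrite -big_split /= (_ : \sum_(k <- kids b) _ = (1 - pot s b) * \sum_(k <- kids b) s k).
    by rewrite /deficit; ring.
  rewrite mulr_sumr big_seq [RHS]big_seq; apply: eq_bigr => k /mem_kids ck.
  by rewrite (pot_child _ ck); ring.
move: IH; rewrite step !sum_ball [in X in _ -> X]big_ord_recr /=.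
rewrite [X in _ -> _ + X + _ = _]big_ord_recr /= => IH; lra.
Qed.

Lemma deficit_bound b n :
  \sum_(a <- ball T n) s a ^+ 2 <= c - (1 - pot s b) * deficit b.
Proof.
have def0 a : 0 <= (1 - pot s a) * deficit a.
  by rewrite mulr_ge0 // subr_ge0 ?tiling_pot_le1 // kids_packing.
pose m := maxn n (depth b).+1.
have [_ root_c _] := root_square.
have := area_balance m; rewrite root_c.
have h1 : (1 - pot s b) * deficit b <=
    \sum_(i < m) \sum_(a <- level T i) (1 - pot s a) * deficit a.
  have lt : (depth b < m)%N by rewrite /m leq_maxr.
  rewrite (bigD1 (Ordinal lt)) //= (bigD1_seq b) ?level_uniq ?mem_level //= -addrA lerDl.
  by apply: addr_ge0; [apply: sumr_ge0|apply: sumr_ge0 => i _; apply: sumr_ge0].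
have h2 : 0 <= \sum_(a <- level T m) (1 - pot s a) * s a.
  by apply: sumr_ge0 => a _; rewrite mulr_ge0 // subr_ge0 tiling_pot_le1.
have h3 : \sum_(a <- ball T n) s a ^+ 2 <= \sum_(a <- ball T m) s a ^+ 2.
  rewrite !sum_ball; have le : (n <= m)%N by rewrite /m leq_maxl.
  rewrite -!(big_mkord xpredT (fun i => \sum_(a <- level T i) s a ^+ 2)).
  rewrite [leRHS](big_cat_nat _ (n := n.+1)) //= lerDl.
  by apply: sumr_ge0 => i _; apply: sumr_ge0 => a _; exact: sqr_ge0.
by move=> h4; lra.
Qed.

(** A deficit under a square that does not touch the bottom would leave a part of
    the rectangle uncovered. *)
Lemma tiling_flow : flow s.
Proof.
move=> b; apply/eqP; rewrite -subr_eq0 -/(deficit b) eq_le.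
rewrite [X in _ && X]subr_ge0 kids_packing andbT.
have [b0|b0] := ltP 0 (s b); last first.
  by rewrite subr_le0; apply: le_trans b0 _; apply: sumr_ge0.
have := area_bound (deficit_bound b); rewrite lerBrDr gerDl -bottom_pot.
by rewrite pmulr_rle0 //; exact: bottom_gt0.
Qed.

Lemma tiling_energy : energy s = c%:E.
Proof.
have le : (energy s <= c%:E)%E.
  apply/energy_leP => n; apply: le_trans (deficit_bound (omega T) n) _.
  by rewrite /deficit -tiling_flow subrr mulr0 subr0.
apply/eqP; rewrite eq_le le /=.
have fin : energy s \is a fin_num.
  by rewrite ge0_fin_numE ?energy_ge0 //; apply: le_lt_trans le _; rewrite ltry.
rewrite -(fineK fin) lee_fin; apply: area_bound; apply/energy_leP.
by rewrite fineK.
Qed.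

End FlowFromTiling.

Lemma tiling_equilibrium (R : realType) (T : rooted_tree) (c : R)
    (Q : edge T -> square R) :
  0 < c -> square_tiling Q (rectangle c) -> prescribed_by Q ->
  covers_ae Q (rectangle c) ->
  (forall a, 0 < sq_side (Q a) -> 0 < sq_bottom (Q a)) ->
  exists (A : set (boundary T)) (mu : {measure set (borel_boundary T) -> \bar R}),
    [/\ Fsigma A, forall a, mu (cylinder a) = (sq_side (Q a))%:E,
        equilibrium_measure A mu & capacity R A = c%:E].
Proof.
move=> c0 tl pr cv bt.
have s0 a : 0 <= sq_side (Q a) by exact: sq_side_ge0.
have fl := tiling_flow c0 tl pr cv bt.
have [_ rt _] := root_square c0 tl pr.
have pt := tiling_pot_le1 c0 tl pr.
have en := tiling_energy c0 tl pr cv bt.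
have [mu muE] := flow_measure s0 fl.
have [A [FA eqA cA]] := equilibrium_of_flow s0 fl rt pt en muE.
by exists A, mu; split.
Qed.

Theorem theorem2 (R : realType) (T : rooted_tree) :
  (forall (A : set (boundary T))
          (mu : {measure set (borel_boundary T) -> \bar R}),
     equilibrium_measure A mu ->
     (0 < capacity R A)%E ->
     exists Q : edge T -> square R,
       [/\ square_tiling Q (rectangle (fine (capacity R A))),
           prescribed_by Q &
           forall a, (sq_side (Q a))%:E = mu (cylinder a)])
  /\
  (forall (c : R) (Q : edge T -> square R),
     0 < c -> c <= 1 ->
     square_tiling Q (rectangle c) ->
     prescribed_by Q ->
     covers_ae Q (rectangle c) ->
     (forall a, 0 < sq_side (Q a) -> 0 < sq_bottom (Q a)) ->
     exists (A : set (boundary T))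
            (mu : {measure set (borel_boundary T) -> \bar R}),
       [/\ Fsigma A,
           forall a, mu (cylinder a) = (sq_side (Q a))%:E,
           equilibrium_measure A mu &
           capacity R A = c%:E]).
Proof.
split; first exact: equilibrium_tiling.
by move=> c Q c0 _; exact: tiling_equilibrium.
Qed.
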